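(* Let $\mathcal{M},\mathcal{N}$ be von Neumann algebras and let $\Phi,\Psi\in\mathrm{CP}(\mathcal{M},\mathcal{N})$. Then, with respect to the order $\le_{\mathrm{cp}}$, \[ \Phi\#\Psi=\max\left\{\Theta\in\mathrm{CP}(\mathcal{M},\mathcal{N})\;\middle|\;\begin{bmatrix}\Phi&\Theta\\ \Theta&\Psi\end{bmatrix}\ge_{\mathrm{cp}}0\right\}, \] i.e. $\Phi\#\Psi$ belongs to the set on the right-hand side and $\Theta\le_{\mathrm{cp}}\Phi\#\Psi$ for every $\Theta$ in that set.
   Context: $\mathrm{CP}(\mathcal{M},\mathcal{N})$ is the set of all completely positive (CP) maps $\mathcal{M}\to\mathcal{N}$ (not assumed normal). $\Phi\le_{\mathrm{cp}}\Psi$ means $\Psi-\Phi$ is CP. For linear maps $\Phi_{ij}:\mathcal{M}\to\mathcal{N}$, $i,j\in\{1,2\}$, $[\Phi_{ij}]\ge_{\mathrm{cp}}0$ means that the map $\mathcal{M}\to M_2(\mathcal{N})$, $x\mapsto[\Phi_{ij}(x)]$, is CP. Forms: for a complex vector space $\mathcal{V}$, $F_+(\mathcal{V})$ is the set of positive sesquilinear forms on $\mathcal{V}$ (linear in the first variable). A compatible representation of $\alpha,\beta\in F_+(\mathcal{V})$ consists of a linear map $h$ from $\mathcal{V}$ onto a dense subspace of a Hilbert space $\mathcal{H}$ and commuting positive $A,B\in\mathbb{B}(\mathcal{H})$ with $\alpha(x,y)=\langle Ah(x),h(y)\rangle$, $\beta(x,y)=\langle Bh(x),h(y)\rangle$.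 By Pusz–Woronowicz such representations always exist, and for a homogeneous locally bounded Borel function $f$ on $[0,\infty)^2$ the form $f(\alpha,\beta)(x,y):=\langle f(A,B)h(x),h(y)\rangle$ does not depend on the choice. The geometric mean is $\alpha\#\beta:=f(\alpha,\beta)$ with $f(r,s)=\sqrt{rs}$. CP maps: $L^2(\mathcal{N})$ is the standard form Hilbert space of $\mathcal{N}$. For $\Phi\in\mathrm{CP}(\mathcal{M},\mathcal{N})$, $s_\Phi$ is the positive sesquilinear form on the algebraic tensor product $\mathcal{M}\odot L^2(\mathcal{N})$ given by $s_\Phi(x\otimes\xi,y\otimes\eta)=\langle\Phi(y^*x)\xi,\eta\rangle$. The geometric mean $\Phi\#\Psi\in\mathrm{CP}(\mathcal{M},\mathcal{N})$ is the unique CP map with $\langle(\Phi\#\Psi)(y^*x)\xi,\eta\rangle=(s_\Phi\#s_\Psi)(x\otimes\xi,y\otimes\eta)$ for all $x,y\in\mathcal{M}$, $\xi,\eta\in L^2(\mathcal{N})$. *)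

(* Defs.v *)
From HB Require Import structures.
From mathcomp Require Import all_boot all_order all_algebra.
From mathcomp Require Import complex.
From mathcomp Require Import all_classical all_reals all_analysis.

Set Implicit Arguments.
Unset Strict Implicit.
Unset Printing Implicit Defensive.

Import Order.TTheory GRing.Theory Num.Theory.
Import numFieldNormedType.Exports.

Local Open Scope classical_set_scope.
Local Open Scope ring_scope.
Local Open Scope complex_scope.

(** Hilbert spaces over R[i]; the inner product is linear in the first variable. *)
HB.mixin Record NormedModule_isHilbert (R : realType) H
    of CompleteNormedModule R[i] H := {
  inner : {dot H for Num.conj};
  sqr_normE : forall x : H, `|x| ^+ 2 = inner x x
}.

#[short(type="hilbertType")]
HB.structure Definition Hilbert (R : realType) :=
  {H of NormedModule_isHilbert R H & CompleteNormedModule R[i] H}.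

Notation "'⟨' x , y '⟩'" := (inner x y)
  (at level 0, x at level 99, y at level 99, format "'⟨' x ,  y '⟩'")
  : ring_scope.

Section Operators.
Context {R : realType} {H : hilbertType R}.
Implicit Types (a b p : H -> H) (A : set (H -> H)).

Definition bounded_op a := linear a /\ continuous a.

Definition is_adjoint a b := forall x y, ⟨a x, y⟩ = ⟨x, b y⟩.

(* In the order of R[i], 0 <= z forces z to be real. *)
Definition positive_op a := bounded_op a /\ forall x, 0 <= ⟨a x, x⟩.

Definition projection_op p := [/\ bounded_op p, p \o p = p & is_adjoint p p].

Definition commutant A : set (H -> H) :=
  [set b | bounded_op b /\ forall a, A a -> a \o b = b \o a].

End Operators.

(* A von Neumann algebra on K: a self-adjoint set of bounded operators equal to
   its double commutant, hence a unital *-subalgebra. *)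
Record vnAlgebra (R : realType) (K : hilbertType R) := VNAlgebra {
  vn_set : set (K -> K);
  vn_adjoint : forall a, vn_set a -> exists2 b, vn_set b & is_adjoint a b;
  vn_bicommutant : commutant (commutant vn_set) = vn_set
}.

Section VNElements.
Context {R : realType} {K : hilbertType R}.
Implicit Type M : vnAlgebra K.

Definition vn_pred M : {pred K -> K} := fun a => a \in vn_set M.

Record vn_elt M := VNElt { vn_val :> K -> K; vn_valP : vn_val \in vn_pred M }.

HB.instance Definition _ M := [isSub for @vn_val M].
HB.instance Definition _ M := [Choice of vn_elt M by <:].

Lemma vn_pred_submod M : submod_closed (vn_pred M).
Proof.
rewrite /vn_pred; split => [|c a b]; rewrite !inE -vn_bicommutant.
  split; first split => [r u v|x]; first by rewrite /= scaler0 addr0.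
    exact: cvg_cst.
  move=> b [[lb _] _]; apply/funext => x /=.
  by have := lb (-1) 0 0; rewrite scaler0 addr0 scaleN1r addNr => ->.
move=> [[la ca] aM] [[lb cb] bM]; split.
  split=> [r u v|x].
    by rewrite !fctE la lb !scalerDr !scalerA [c * r]mulrC addrACA.
  by apply: cvgD; [apply: cvgZ; [exact: cvg_cst|exact: ca]|exact: cb].
move=> d dM; have [[ld _] _] := dM; apply/funext => x /=.
have /(congr1 (@^~ x)) /= ad := aM _ dM.
have /(congr1 (@^~ x)) /= bd := bM _ dM.
by rewrite !fctE ld ad bd.
Qed.

HB.instance Definition _ M :=
  GRing.isSubmodClosed.Build R[i] (K -> K) (vn_pred M) (vn_pred_submod M).
HB.instance Definition _ M := [SubChoice_isSubLmodule of vn_elt M by <:].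

Lemma vn_mul_subproof M (a b : vn_elt M) : (a \o b : K -> K) \in vn_pred M.
Proof.
move: (vn_valP a) (vn_valP b); rewrite /vn_pred !inE -vn_bicommutant.
move=> [[la ca] aM] [[lb cb] bM]; split.
  split=> [r u v /=|x]; first by rewrite lb la.
  by apply: continuous_comp; [exact: cb|exact: ca].
by move=> d dM; rewrite compA (aM _ dM) -compA (bM _ dM) compA.
Qed.

Definition vn_mul M (a b : vn_elt M) : vn_elt M := VNElt (vn_mul_subproof a b).

Lemma vn_star_subproof M (a : vn_elt M) :
  exists b : vn_elt M, is_adjoint a b.
Proof.
have /set_mem/vn_adjoint[b /mem_set bM ab] := vn_valP a.
by exists (VNElt bM).
Qed.

Definition vn_star M (a : vn_elt M) : vn_elt M :=
  sval (cid (vn_star_subproof a)).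

Lemma vn_starP M (a : vn_elt M) : is_adjoint a (vn_star a).
Proof. exact: svalP (cid (vn_star_subproof a)). Qed.

(* The matrix [a i j] is positive as an operator on the Hilbert sum K^I. *)
Definition positive_mx M (I : finType) (a : I -> I -> vn_elt M) :=
  forall xi : I -> K, 0 <= \sum_i \sum_j ⟨a i j (xi j), xi i⟩.

End VNElements.

Coercion vn_elt : vnAlgebra >-> Sortclass.

Section CompletelyPositive.
Context {R : realType} {K L : hilbertType R}.
Context {M : vnAlgebra K} {N : vnAlgebra L}.
Implicit Types Phi Psi Theta : M -> N.

Definition is_cp Phi := linear Phi /\
  forall n (a : 'I_n -> 'I_n -> M), positive_mx a ->
    positive_mx (fun i j => Phi (a i j)).

Definition cp_le Phi Psi := is_cp (Psi \- Phi).

(* Complete positivity of x |-> [Phi i j x] : M -> M_m(N), where M_n(M_m(N))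
   is identified with the matrices over N indexed by 'I_n * 'I_m. *)
Definition is_cp_mx m (Phi : 'I_m -> 'I_m -> M -> N) :=
  (forall i j, linear (Phi i j)) /\
  forall n (a : 'I_n -> 'I_n -> M), positive_mx a ->
    positive_mx (fun p q : 'I_n * 'I_m => Phi p.2 q.2 (a p.1 q.1)).

Definition block2 (Phi11 Phi12 Phi21 Phi22 : M -> N) (i j : 'I_2) : M -> N :=
  if i == 0 then (if j == 0 then Phi11 else Phi12)
  else (if j == 0 then Phi21 else Phi22).

Definition is_cp_max (S : set (M -> N)) Phi :=
  S Phi /\ forall Theta, S Theta -> cp_le Theta Phi.

End CompletelyPositive.

(** Haagerup's axioms for a standard form (pi(N), L^2(N), J, P); the Hilbert
    space L^2(N) is unique up to a unitary intertwining the representations. *)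
Record standardForm (R : realType) (L : hilbertType R) (N : vnAlgebra L) :=
    StandardForm {
  L2 : hilbertType R;
  std_alg : vnAlgebra L2;
  std_rep : N -> std_alg;
  std_conj : L2 -> L2;
  std_cone : set L2;
  std_rep_linear : linear std_rep;
  std_rep_mul : forall a b, std_rep (vn_mul a b) = vn_mul (std_rep a) (std_rep b);
  std_rep_star : forall a, std_rep (vn_star a) = vn_star (std_rep a);
  std_rep_bij : bijective std_rep;
  std_conj_antilinear : forall (c : R[i]) x y,
    std_conj (c *: x + y) = Num.conj c *: std_conj x + std_conj y;
  std_conj_norm : forall x, `|std_conj x| = `|x|;
  std_conjK : involutive std_conj;
  std_cone_self_dual :
    std_cone = [set y | forall x, std_cone x -> 0 <= ⟨x, y⟩];
  std_conj_commutant : forall b : L2 -> L2,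
    commutant (vn_set std_alg) b <->
    vn_set std_alg (std_conj \o b \o std_conj);
  std_conj_center : forall c : std_alg, commutant (vn_set std_alg) c ->
    std_conj \o c \o std_conj = vn_star c;
  std_conj_cone : forall x, std_cone x -> std_conj x = x;
  std_cone_stable : forall (a : std_alg) x, std_cone x ->
    std_cone (a (std_conj (a (std_conj x))))
}.

Section BorelCalculus.
Context {R : realType}.

(* Spectral measures on the plane; countable additivity is that of the
   measures S |-> <E(S) x, x>. *)
Record spectralMeasure (H : hilbertType R) := SpectralMeasure {
  spm_proj :> set (R * R) -> H -> H;
  spm_meas : H -> {measure set (R * R) -> \bar R};
  spm_projP : forall S, measurable S -> projection_op (spm_proj S);
  spm_projT : spm_proj setT = id;
  spm_projI : forall S T, measurable S -> measurable T ->
    spm_proj (S `&` T) = spm_proj S \o spm_proj T;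
  spm_measE : forall x S, measurable S ->
    spm_meas x S = (complex.Re ⟨spm_proj S x, x⟩)%:E
}.

Context {H : hilbertType R}.
Implicit Types (A B T : H -> H) (E : spectralMeasure H) (f : R * R -> R).

(* T = \int f dE, for f bounded on the support of E. *)
Definition is_spectral_integral E f T := forall x,
  (spm_meas E x).-integrable setT (EFin \o f) /\
  ⟨T x, x⟩ = (\int[spm_meas E x]_p f p)%:C.

Definition joint_spectral_measure A B E :=
  [/\ E (`[0, +oo[ `*` `[0, +oo[) = id,
      is_spectral_integral E (fun p => p.1) A &
      is_spectral_integral E (fun p => p.2) B].

(* T = f(A, B) for commuting positive A and B, f being relevant only on
   [0, oo[^2. *)
Definition is_borel_calculus f A B T :=
  bounded_op T /\
  exists2 E, joint_spectral_measure A B E & is_spectral_integral E f T.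

End BorelCalculus.

Section Forms.
Context {R : realType} {V : lmodType R[i]}.
Implicit Types (alpha beta gamma : V -> V -> R[i]).

Definition positive_form alpha :=
  [/\ forall c x y z, alpha (c *: x + y) z = c * alpha x z + alpha y z,
      forall c x y z, alpha z (c *: x + y) = Num.conj c * alpha z x + alpha z y &
      forall x, 0 <= alpha x x].

Definition compatible_rep alpha beta (H : hilbertType R) (h : V -> H)
    (A B : H -> H) :=
  [/\ linear h, dense (range h),
      positive_op A, positive_op B & A \o B = B \o A] /\
  [/\ forall x y, alpha x y = ⟨A (h x), h y⟩ &
      forall x y, beta x y = ⟨B (h x), h y⟩].

(* gamma = f(alpha, beta); the form does not depend on the compatible
   representation. *)
Definition is_form_calculus (f : R * R -> R) alpha beta gamma :=
  exists (H : hilbertType R) (h : V -> H) (A B T : H -> H),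
  [/\ compatible_rep alpha beta h A B, is_borel_calculus f A B T &
      forall x y, gamma x y = ⟨T (h x), h y⟩].

Definition is_form_gmean := is_form_calculus (fun p => Num.sqrt (p.1 * p.2)).

End Forms.

(* Algebraic tensor product of vector spaces, by its universal property. *)
Definition is_tensor_product (C : fieldType) (X Y V : lmodType C)
    (t : {bilinear X -> Y -> V}) :=
  forall (W : lmodType C) (b : {bilinear X -> Y -> W}),
  exists g : {linear V -> W}, (forall x y, g (t x y) = b x y) /\
    forall g' : {linear V -> W}, (forall x y, g' (t x y) = b x y) -> g' =1 g.

Section CPGeometricMean.
Context {R : realType} {K L : hilbertType R}.
Context {M : vnAlgebra K} {N : vnAlgebra L} (F : standardForm N).
Context {V : lmodType R[i]} (t : {bilinear M -> L2 F -> V}).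
Implicit Types Phi Psi Gamma : M -> N.

(* s = s_Phi, which is determined by its values on elementary tensors *)
Definition is_cp_form Phi (s : V -> V -> R[i]) :=
  positive_form s /\
  forall (x y : M) (xi eta : L2 F),
    s (t x xi) (t y eta) =
    ⟨std_rep F (Phi (vn_mul (vn_star y) x)) xi, eta⟩.

(* Gamma = Phi # Psi *)
Definition is_cp_gmean Phi Psi Gamma :=
  is_cp Gamma /\
  exists sPhi sPsi s : V -> V -> R[i],
  [/\ is_cp_form Phi sPhi, is_cp_form Psi sPsi, is_form_gmean sPhi sPsi s &
      forall (x y : M) (xi eta : L2 F),
        ⟨std_rep F (Gamma (vn_mul (vn_star y) x)) xi, eta⟩ =
        s (t x xi) (t y eta)].

End CPGeometricMean.

(* Main.v *)
Require Import Defs.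
From HB Require Import structures.
From mathcomp Require Import all_boot all_order all_algebra.
From mathcomp Require Import complex ring lra.
From mathcomp Require Import all_classical all_reals all_analysis.

(** Why the geometric mean is maximal.

    The statement about maps is reduced to one about forms on the algebraic
    tensor product V of M and L^2(N). A positive matrix over a von Neumann
    algebra is, up to an arbitrarily small multiple of the identity, a positive
    multiple of a sum of Gram matrices with entries x_i^* x_j: once an invertible
    positive matrix is scaled to lie between e and 1, the iteration for its
    square root is a contraction, and the limit has its entries in the
    bicommutant ([positive_mx_factor]). Hence the positivity of an expression
    that depends linearly on a positive matrix only has to be checked on Gram
    matrices ([positive_mx_ind]). In particular an isomorphism of von Neumann
    algebras preserves positive matrices, so that positivity in N may be tested
    on L^2(N) ([std_positive]); and on a Gram matrix the quadratic expressions
    that define complete positivity are values of the forms s_Phi at sums of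
    elementary tensors ([cp_form_gram], [cp_form_block]), which exhaust V
    ([tensor_spanned]).

    What remains is the same theorem for forms: if s is the geometric mean of
    alpha and beta, then the block form with entries alpha, s, s, beta is
    positive ([gmean_form_block]), and a positive form theta such that the block
    form with entries alpha, theta, theta, beta is positive satisfies theta <= s
    ([gmean_form_max]). Up to an arbitrarily small error, the commuting operators
    A, B and sqrt (A B) are replaced by combinations of finitely many orthogonal
    projections P_j with coefficients a_j, b_j > 0 and sqrt (a_j b_j): the values
    of the joint spectral measure on the cells of a fine grid ([spectral_grid]).
    The first claim then is a u^2 + 2 sqrt (a b) u v + b v^2 >= 0. The second one
    ([step_gmean_max]) is a version of the fact that X^2 <= Y^2 implies X <= Y
    for X selfadjoint and Y positive, and is proved like it: at a vector where
    theta - sqrt (a b), compared with b, nearly attains its supremum l, the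
    defining inequality of a supremum is nearly an equality, which for l > 0
    contradicts the block positivity ([gap_decrease]). That vector only has to
    be sought in V, and its image under sqrt (a / b) + l is replaced by a nearby
    image of a vector of V, so theta never has to be extended to the Hilbert
    space. *)

Set Implicit Arguments.
Unset Strict Implicit.
Unset Printing Implicit Defensive.

Import Order.TTheory GRing.Theory Num.Theory.
Import numFieldNormedType.Exports.

Local Open Scope classical_set_scope.
Local Open Scope ring_scope.
Local Open Scope complex_scope.

Local Notation Re := complex.Re.
Local Notation Im := complex.Im.

(** * Complex numbers and quadratic forms *)

Section ComplexNumbers.
Context {R : realType}.
Implicit Types (z w : R[i]) (r : R).

Lemma ReD z w : Re (z + w) = Re z + Re w.
Proof. by case: z w => ? ? []. Qed.

Lemma ReN z : Re (- z) = - Re z.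
Proof. by case: z. Qed.

Lemma complex_Re_conj z : Re (Num.conj z) = Re z.
Proof. by case: z. Qed.

Lemma conj_realC r : Num.conj r%:C = r%:C.
Proof. by rewrite /Num.conj /= oppr0. Qed.

Lemma ReZ r z : Re (r%:C * z) = r * Re z.
Proof. by case: z => a b /=; rewrite mul0r subr0. Qed.

Lemma ReiM z : Re (- 'i * z) = Im z.
Proof. by case: z => a b /=; rewrite oppr0 mul0r sub0r mulN1r opprK. Qed.

Lemma Re_sum (I : Type) (s : seq I) (P : pred I) (F : I -> R[i]) :
  Re (\sum_(i <- s | P i) F i) = \sum_(i <- s | P i) Re (F i).
Proof. by apply: (big_morph _ ReD). Qed.

Lemma complex_ge0 z : 0 <= z <-> Im z = 0 /\ 0 <= Re z.
Proof.
rewrite lecE /=; split=> [/andP[/eqP -> ->]//|[-> ->]]; by rewrite eqxx.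
Qed.

Lemma Re_ge0 z : 0 <= z -> 0 <= Re z.
Proof. by move/complex_ge0 => []. Qed.

Lemma ge0_ReE z : 0 <= z -> z = (Re z)%:C.
Proof. by case: z => a b /complex_ge0[/= -> _]. Qed.

End ComplexNumbers.

Section RealForms.
Context {R : realType} {V : lmodType R[i]}.
Implicit Types (q : V -> V -> R) (x y z : V) (r : R).

(** Real parts of sesquilinear forms are handled as symmetric forms that are
    linear over the real scalars only; all estimates are made on them. *)
Definition real_form q :=
  [/\ forall x y z, q (x + y) z = q x z + q y z,
      forall r x y, q (r%:C *: x) y = r * q x y &
      forall x y, q x y = q y x].

Definition psd_form q := real_form q /\ forall x, 0 <= q x x.

Section RealFormTheory.
Variable q : V -> V -> R.
Hypothesis qr : real_form q.

Lemma rformC x y : q x y = q y x. Proof. by case: qr. Qed.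

Lemma rformDl x y z : q (x + y) z = q x z + q y z. Proof. by case: qr. Qed.

Lemma rformDr x y z : q z (x + y) = q z x + q z y.
Proof. by rewrite rformC rformDl !(rformC z). Qed.

Lemma rformZl r x y : q (r%:C *: x) y = r * q x y. Proof. by case: qr. Qed.

Lemma rformZr r x y : q x (r%:C *: y) = r * q x y.
Proof. by rewrite rformC rformZl rformC. Qed.

Lemma rformNl x y : q (- x) y = - q x y.
Proof. by rewrite -scaleN1r -(rmorphN1 (real_complex R)) rformZl mulN1r. Qed.

Lemma rformNr x y : q x (- y) = - q x y.
Proof. by rewrite rformC rformNl rformC. Qed.

Lemma rform0l y : q 0 y = 0.
Proof. by rewrite -(scale0r 0) -(rmorph0 (real_complex R)) rformZl mul0r. Qed.

Lemma rform0r y : q y 0 = 0.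
Proof. by rewrite rformC rform0l. Qed.

Definition rformE := (rformDl, rformDr, rformNl, rformNr, rformZl, rformZr).

End RealFormTheory.

Section PsdFormTheory.
Variable q : V -> V -> R.
Hypothesis qp : psd_form q.

Let qr : real_form q. Proof. by case: qp. Qed.

Lemma psd_ge0 x : 0 <= q x x. Proof. by case: qp. Qed.

Lemma psd_amgm r x y : 0 < r -> 2 * q x y <= r * q x x + r^-1 * q y y.
Proof.
move=> r0; have := psd_ge0 (r%:C *: x - y).
rewrite !(rformE qr) (rformC qr y) => h.
rewrite -(ler_pM2l r0) mulrDr !mulrA mulfV ?gt_eqF// mul1r; lra.
Qed.

Lemma psd_cauchy_schwarz x y : q x y ^+ 2 <= q x x * q y y.
Proof.
have [x0|x0] := eqVneq (q x x) 0.
  suff -> : q x y = 0 by rewrite expr2 !mul0r mulr_ge0 ?psd_ge0.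
  apply/eqP/contraT => xy0.
  have := psd_ge0 ((- ((q y y + 1) / (2 * q x y)))%:C *: x + y).
  rewrite !(rformE qr) (rformC qr y) x0.
  have -> : - ((q y y + 1) / (2 * q x y)) *
      (- ((q y y + 1) / (2 * q x y)) * 0 + q x y) +
      (- ((q y y + 1) / (2 * q x y)) * q x y + q y y) = -1.
    by field.
  by rewrite ler0N1.
have {}x0 : 0 < q x x by rewrite lt_def x0 psd_ge0.
have := psd_ge0 ((- (q x y / q x x))%:C *: x + y).
rewrite !(rformE qr) (rformC qr y).
have -> : - (q x y / q x x) * (- (q x y / q x x) * q x x + q x y) +
   (- (q x y / q x x) * q x y + q y y) = (q x x * q y y - q x y ^+ 2) / q x x.
  by field; rewrite gt_eqF.
by rewrite pmulr_lge0 ?invr_gt0// subr_ge0.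
Qed.

Definition fnorm x := Num.sqrt (q x x).

Lemma fnorm_ge0 x : 0 <= fnorm x. Proof. exact: sqrtr_ge0. Qed.

Lemma fnorm_sqr x : fnorm x ^+ 2 = q x x.
Proof. by rewrite sqr_sqrtr ?psd_ge0. Qed.

Lemma fnormZ r x : fnorm (r%:C *: x) = `|r| * fnorm x.
Proof.
by rewrite /fnorm !(rformE qr) mulrA -expr2 sqrtrM ?sqr_ge0// sqrtr_sqr.
Qed.

Lemma fnormN x : fnorm (- x) = fnorm x.
Proof. by rewrite /fnorm !(rformE qr) opprK. Qed.

Lemma fnorm0 : fnorm 0 = 0.
Proof. by rewrite /fnorm rform0l// sqrtr0. Qed.

Lemma le_fnormM x y : q x y <= fnorm x * fnorm y.
Proof.
rewrite -sqrtrM ?psd_ge0//; apply: le_trans (ler_norm _) _.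
by rewrite -sqrtr_sqr ler_wsqrtr// psd_cauchy_schwarz.
Qed.

Lemma fnormD x y : fnorm (x + y) <= fnorm x + fnorm y.
Proof.
rewrite -(@ler_pXn2r _ 2)// ?nnegrE ?addr_ge0 ?fnorm_ge0//.
rewrite sqrrD !fnorm_sqr !(rformE qr) (rformC qr y).
have := le_fnormM x y; lra.
Qed.

Lemma fnormB x y : fnorm (x - y) <= fnorm x + fnorm y.
Proof. by rewrite -[fnorm y]fnormN fnormD. Qed.

Lemma fnormC x y : fnorm (x - y) = fnorm (y - x).
Proof. by rewrite -fnormN opprB. Qed.

End PsdFormTheory.

Lemma real_formZ r q : real_form q -> real_form (fun x y => r * q x y).
Proof.
move=> qr; split=> [x y z|s x y|x y]; last by rewrite (rformC qr).
- by rewrite rformDl // mulrDr.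
- by rewrite rformZl // mulrCA.
Qed.

Lemma real_form_sum (I : finType) (q : I -> V -> V -> R) :
  (forall i, real_form (q i)) -> real_form (fun x y => \sum_i q i x y).
Proof.
move=> qr; split=> [x y z|s x y|x y].
- by rewrite -big_split /=; apply: eq_bigr => i _; rewrite rformDl.
- by rewrite mulr_sumr; apply: eq_bigr => i _; rewrite rformZl.
- by apply: eq_bigr => i _; rewrite (rformC (qr i)).
Qed.

Section PositiveForm.
Variable s : V -> V -> R[i].
Hypothesis sp : positive_form s.

Lemma pformDl x y z : s (x + y) z = s x z + s y z.
Proof. by case: sp => h _ _; rewrite -[x]scale1r h mul1r scale1r. Qed.

Lemma pformDr x y z : s z (x + y) = s z x + s z y.
Proof. by case: sp => _ h _; rewrite -[x]scale1r h rmorph1 mul1r scale1r. Qed.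

Lemma pform0l y : s 0 y = 0.
Proof. by apply: (addrI (s 0 y)); rewrite -pformDl !addr0. Qed.

Lemma pform0r y : s y 0 = 0.
Proof. by apply: (addrI (s y 0)); rewrite -pformDr !addr0. Qed.

Lemma pformZl c x y : s (c *: x) y = c * s x y.
Proof. by case: sp => h _ _; rewrite -[c *: x]addr0 h pform0l addr0. Qed.

Lemma pformZr c x y : s x (c *: y) = Num.conj c * s x y.
Proof. by case: sp => _ h _; rewrite -[c *: y]addr0 h pform0r addr0. Qed.

Lemma pformNl x y : s (- x) y = - s x y.
Proof. by rewrite -scaleN1r pformZl mulN1r. Qed.

Lemma pformNr x y : s x (- y) = - s x y.
Proof. by rewrite -scaleN1r pformZr rmorphN1 mulN1r. Qed.

Lemma pform_ge0 x : 0 <= s x x. Proof. by case: sp. Qed.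

Lemma pform_sumr (I : Type) (l : seq I) (F : I -> V) x :
  s x (\sum_(i <- l) F i) = \sum_(i <- l) s x (F i).
Proof. by apply: (big_morph _ (fun a b => pformDr a b x) (pform0r x)). Qed.

Lemma pform_suml (I : Type) (l : seq I) (F : I -> V) x :
  s (\sum_(i <- l) F i) x = \sum_(i <- l) s (F i) x.
Proof. by apply: (big_morph _ (fun a b => pformDl a b x) (pform0l x)). Qed.

(** Polarization: the real and imaginary parts of the identity are read off from
    the fact that s is real at x + y and at i x + y. *)
Lemma pform_conj x y : s y x = Num.conj (s x y).
Proof.
have h1 := pform_ge0 (x + y); have h2 := pform_ge0 ('i *: x + y).
have /complex_ge0[hx _] := pform_ge0 x; have /complex_ge0[hy _] := pform_ge0 y.
move: h1 h2; rewrite !(pformDl, pformDr) !(pformZl, pformZr) =>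
  /complex_ge0[h1 _].
move=> /complex_ge0[h2 _].
move: hx hy h1 h2; case: (s x x) (s y y) (s x y) (s y x) => [a b] [c
  d] [e f] [g h] /=.
move=> -> ->; rewrite !(mul0r, mulr0, mul1r, mulN1r, addr0, add0r,
  subr0, sub0r, oppr0).
move=> h1 h2; congr (_ +i* _); lra.
Qed.

Lemma positive_form_psd : psd_form (fun x y => Re (s x y)).
Proof.
split=> [|x]; last exact/Re_ge0/pform_ge0.
split=> [x y z|r x y|x y]; first by rewrite pformDl ReD.
  by rewrite pformZl ReZ.
by rewrite (pform_conj y x) complex_Re_conj.
Qed.

Lemma pform_diagE x : s x x = (Re (s x x))%:C.
Proof. exact/ge0_ReE/pform_ge0. Qed.

End PositiveForm.
End RealForms.

Section Inner.
Context {R : realType} {H : hilbertType R}.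
Implicit Types x y z : H.

Lemma inner_positive : positive_form (fun x y : H => ⟨x, y⟩).
Proof.
split=> [c x y z|c x y z|x].
- by rewrite linearDl linearZl_LR.
- by rewrite linearDr linearZr_LR.
- by rewrite -sqr_normE exprn_ge0.
Qed.

Definition innerDl := pformDl inner_positive.
Definition innerDr := pformDr inner_positive.
Definition innerZl := pformZl inner_positive.
Definition innerZr := pformZr inner_positive.
Definition inner0l := pform0l inner_positive.
Definition inner0r := pform0r inner_positive.
Definition inner_suml := pform_suml inner_positive.
Definition inner_sumr := pform_sumr inner_positive.
Definition inner_conj := pform_conj inner_positive.
Definition inner_ge0 := pform_ge0 inner_positive.

Definition rip x y := Re ⟨x, y⟩.

Lemma rip_psd : psd_form rip.
Proof. exact: positive_form_psd inner_positive. Qed.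

Lemma norm_fnorm x : `|x| = (fnorm rip x)%:C.
Proof.
apply/eqP; rewrite -(@eqrXn2 _ 2)// ?lecR ?fnorm_ge0 ?ler0c ?fnorm_ge0//.
rewrite sqr_normE -rmorphXn /= fnorm_sqr; last exact: rip_psd.
by rewrite (pform_diagE inner_positive).
Qed.

Lemma inner_eq0 x : ⟨x, x⟩ = 0 -> x = 0.
Proof. by rewrite -sqr_normE => /eqP;
  rewrite expf_eq0 /= normr_eq0 => /eqP. Qed.

Lemma rip_eq0 x : rip x x = 0 -> x = 0.
Proof. by move=> h; apply: inner_eq0;
  rewrite (pform_diagE inner_positive) -/(rip x x) h. Qed.

Lemma innerI x y : (forall z, ⟨x, z⟩ = ⟨y, z⟩) -> x = y.
Proof.
move=> h; apply/subr0_eq/inner_eq0; rewrite innerDl -scaleN1r innerZl -h.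
by rewrite mulN1r subrr.
Qed.

End Inner.

(** * Square roots by iteration *)

(** Linearity is a hypothesis on bare functions here, as in the definitions of
    bounded operators and of CP maps. *)
Section LinearMaps.
Context {R : pzRingType} {U W : lmodType R}.
Variable f : U -> W.
Hypothesis fl : linear f.

Lemma lin_addE x y : f (x + y) = f x + f y.
Proof. by rewrite -[x]scale1r fl !scale1r. Qed.

Lemma lin_0E : f 0 = 0.
Proof. by apply: (addrI (f 0)); rewrite -lin_addE !addr0. Qed.

Lemma lin_scaleE c x : f (c *: x) = c *: f x.
Proof. by rewrite -[c *: x]addr0 fl lin_0E addr0. Qed.

Lemma lin_oppE x : f (- x) = - f x.
Proof. by rewrite -!scaleN1r lin_scaleE. Qed.

Lemma lin_subE x y : f (x - y) = f x - f y.
Proof. by rewrite addrC -[- y]scaleN1r fl scaleN1r addrC. Qed.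

Lemma lin_sumE (I : Type) (l : seq I) (P : pred I) (F : I -> U) :
  f (\sum_(i <- l | P i) F i) = \sum_(i <- l | P i) f (F i).
Proof. exact: (big_morph f lin_addE lin_0E). Qed.

End LinearMaps.

Section SquareRootIteration.
Context {R : realType} {V : lmodType R[i]} (s : V -> V -> R[i]).
Hypothesis sp : positive_form s.

Let q x y := Re (s x y).
Let qp : psd_form q := positive_form_psd sp.
Let qr : real_form q := qp.1.
Local Notation nrm := (fnorm q).

Lemma fnorm_scale c x : nrm (c *: x) = Re `|c| * nrm x.
Proof.
have c0 : 0 <= Re `|c| by apply: Re_ge0.
rewrite /fnorm /q pformZl // pformZr // mulrA -normCK.
by rewrite (ge0_ReE (normr_ge0 c)) -rmorphXn ReZ sqrtrM ?sqr_ge0//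
  sqrtr_sqr ger0_norm.
Qed.

(** Convergence for the seminorm of s; V itself carries no topology. *)
Definition fcvg (u : nat -> V) l :=
  forall e, 0 < e -> exists K, forall k, (K <= k)%N -> nrm (u k - l) <= e.

Lemma fcvg_lipschitz f c u l : (forall x y, nrm (f x - f y) <=
  c * nrm (x - y)) ->
  fcvg u l -> fcvg (f \o u) (f l).
Proof.
move=> fc ul e e0; have c1 : 0 < `|c| + 1 by rewrite ltr_wpDl.
have [K hK] := ul (e / (`|c| + 1)) (divr_gt0 e0 c1).
exists K => k /hK /= h; apply: le_trans (fc _ _) _.
have := ler_norm c; have n0 := fnorm_ge0 q (u k - l) => cc.
apply: (@le_trans _ _ ((`|c| + 1) * nrm (u k - l))).
  by rewrite ler_wpM2r // ler_wpDr.
by rewrite mulrC -ler_pdivlMr.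
Qed.

Lemma fcvgD u v l m : fcvg u l -> fcvg v m -> fcvg (fun k => u k + v k) (l + m).
Proof.
move=> ul vm e e0; have e2 : 0 < e / 2 by rewrite divr_gt0.
have [K hK] := ul _ e2; have [L hL] := vm _ e2.
exists (maxn K L) => k; rewrite geq_max => /andP[/hK h1 /hL h2].
rewrite opprD addrACA [e]splitr; apply: le_trans (fnormD qp _ _) _; exact: lerD.
Qed.

Hypothesis s0 : forall x, s x x = 0 -> x = 0.

Lemma fcvg_unique u l m : fcvg u l -> fcvg u m -> l = m.
Proof.
move=> ul um; apply/subr0_eq/s0; rewrite (pform_diagE sp).
suff : nrm (l - m) <= 0.
  by rewrite le_eqVlt ltNge fnorm_ge0 orbF /fnorm sqrtr_eq0 => h;
     rewrite -[Re _]/(q _ _) (le_anti (introT andP (conj h (psd_ge0 qp _)))).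
apply/ler_addgt0Pl => e e0; rewrite addr0.
have e2 : 0 < e / 2 by rewrite divr_gt0.
have [K hK] := ul _ e2; have [L hL] := um _ e2.
have -> : l - m = (l - u (maxn K L)) + (u (maxn K L) - m).
  by rewrite addrA subrK.
rewrite [e]splitr; apply: le_trans (fnormD qp _ _) _; apply: lerD.
  by rewrite fnormC//; apply: hK; rewrite leq_maxl.
by apply: hL; rewrite leq_maxr.
Qed.

Hypothesis scomplete : forall (u : nat -> V) c r, 0 <= r < 1 ->
  (forall k, nrm (u k.+1 - u k) <= c * r ^+ k) -> exists l, fcvg u l.

Variables (b : V -> V) (r : R).
Hypotheses (bl : linear b) (b0 : forall x, 0 <= s (b x) x).
Hypothesis br : forall x, q (b x) x <= r * q x x.
Hypothesis r01 : 0 <= r < 1.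

Let r0 : 0 <= r. Proof. by case/andP: r01. Qed.

Let bform : positive_form (fun x y => s (b x) y).
Proof.
split=> // c x y z; first by rewrite bl pformDl// pformZl.
by rewrite pformDr // pformZr.
Qed.

Lemma positive_symmetric x y : s (b x) y = s x (b y).
Proof. by rewrite (pform_conj bform y x) -(pform_conj sp). Qed.

(** Cauchy-Schwarz for the form of b gives
    |b x|^2 <= (b x, x)^(1/2) (b b x, b x)^(1/2) <= r |x| |b x|. *)
Lemma positive_contraction x : nrm (b x) <= r * nrm x.
Proof.
have h : q (b x) (b x) <= r * nrm x * nrm (b x).
  apply: le_trans (le_fnormM (positive_form_psd bform) x (b x)) _.
  have sr z : fnorm (fun x y => Re (s (b x) y)) z <= Num.sqrt r * nrm z.
    by rewrite -sqrtrM// ler_wsqrtr// br.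
  apply: le_trans (ler_pM (fnorm_ge0 _ _) (fnorm_ge0 _ _) (sr x) (sr (b x))) _.
  by rewrite mulrACA -expr2 sqr_sqrtr// mulrA.
have [b1|b1] := eqVneq (nrm (b x)) 0; first by rewrite b1 mulr_ge0 // fnorm_ge0.
by rewrite -(@ler_pM2r _ (nrm (b x))) ?lt_def ?b1 ?fnorm_ge0// -expr2 fnorm_sqr.
Qed.

(** With b = 1 - a, the limit y of this iteration solves y = (b + y^2) / 2,
    that is (1 - y)^2 = a. *)
Fixpoint sqrt_iter k x :=
  if k is k'.+1 then (2^-1)%:C *: (b x + sqrt_iter k' (sqrt_iter k' x)) else 0.

Local Notation Y := sqrt_iter.

Lemma sqrt_iter_linear k : linear (Y k).
Proof.
elim: k => [|k ih] c x y /=; first by rewrite scaler0 addr0.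
by rewrite bl !ih scalerA mulrC -scalerA -scalerDr; congr (_ *: _);
   rewrite scalerDr addrACA.
Qed.

Lemma sqrt_iter_le k x : nrm (Y k x) <= r * nrm x.
Proof.
elim: k x => [|k ih] x /=; first by rewrite fnorm0// mulr_ge0 ?fnorm_ge0.
rewrite fnormZ// ger0_norm ?invr_ge0// mulrC ler_pdivrMr//.
apply: le_trans (fnormD qp _ _) _; rewrite mulr_natr mulr2n.
apply: lerD (positive_contraction x) _; apply: le_trans (ih _) _.
apply: ler_wpM2l => //; apply: le_trans (ih _) _.
by rewrite ler_piMl ?fnorm_ge0//; case/andP: r01 => _ /ltW.
Qed.

(** The iteration contracts by r, since y^2 - z^2 = y (y - z) + (y - z) z and
    all iterates have norm at most r. *)
Lemma sqrt_iter_step k x : nrm (Y k.+1 x - Y k x) <= r * nrm x * r ^+ k.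
Proof.
elim: k x => [|k ih] x.
  rewrite expr0 mulr1 subr0; exact: (sqrt_iter_le 1 x).
have -> : Y k.+2 x - Y k.+1 x = (2^-1)%:C *: (Y k.+1 (Y k.+1 x - Y k x) +
     (Y k.+1 (Y k x) - Y k (Y k x))).
  rewrite (lin_subE (sqrt_iter_linear k.+1)).
  by rewrite addrA subrK /= -scalerBr opprD addrACA subrr add0r.
rewrite fnormZ// ger0_norm ?invr_ge0// mulrC ler_pdivrMr//.
apply: le_trans (fnormD qp _ _) _; rewrite mulr_natr mulr2n.
have e : r * nrm x * r ^+ k.+1 = r * (r * nrm x * r ^+ k) by
  rewrite exprS; ring.
apply: lerD; first by apply: le_trans (sqrt_iter_le _ _) _; rewrite e ler_wpM2l.
apply: le_trans (ih _) _.
have -> : r * nrm x * r ^+ k.+1 = r * (r * nrm x) * r ^+ k by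
  rewrite exprS; ring.
by rewrite ler_wpM2r ?exprn_ge0// ler_wpM2l// sqrt_iter_le.
Qed.

Lemma sqrt_iter_cvg x : exists l, fcvg (fun k => Y k x) l.
Proof. exact: scomplete r01 (fun k => sqrt_iter_step k x). Qed.

Definition sqrt_lim x := sval (cid (sqrt_iter_cvg x)).
Local Notation y := sqrt_lim.

Lemma sqrt_limP x : fcvg (fun k => Y k x) (y x).
Proof. by rewrite /sqrt_lim; case: cid. Qed.

Lemma sqrt_lim_linear : linear y.
Proof.
move=> c u v; apply: fcvg_unique (sqrt_limP _) _.
under eq_fun do rewrite sqrt_iter_linear.
apply: fcvgD (sqrt_limP _).
apply: (@fcvg_lipschitz (fun z => c *: z) (Re `|c|)) (sqrt_limP _) => x z.
by rewrite -scalerBr fnorm_scale.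
Qed.

Lemma sqrt_lim_le x : nrm (y x) <= r * nrm x.
Proof.
apply/ler_addgt0Pl => e e0; have [K /(_ K (leqnn K)) hK] := sqrt_limP x e0.
rewrite -[y x](subKr (Y K x)); apply: le_trans (fnormB qp _ _) _.
by rewrite addrC lerD// sqrt_iter_le.
Qed.

Lemma sqrt_limE x : y x + y x = b x + y (y x).
Proof.
have h : fcvg (fun k => Y k.+1 x) (y x).
  by move=> e /(sqrt_limP x)[K hK]; exists K => k Kk; apply: hK; rewrite ltnW.
have h2 : fcvg (fun k => Y k (Y k x)) (y (y x)).
  have -> : (fun k => Y k (Y k x)) =
      (fun k => Y k (Y k x - y x) + Y k (y x)).
    apply/funext => k; by rewrite (lin_subE (sqrt_iter_linear k)) subrK.
  rewrite -[y (y x)]add0r; apply: fcvgD; last exact: sqrt_limP.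
  move=> e /(sqrt_limP x)[K hK]; exists K => k /hK; apply: le_trans.
  rewrite subr0; apply: le_trans (sqrt_iter_le _ _) _.
  by rewrite ler_piMl ?fnorm_ge0//; case/andP: r01 => _ /ltW.
suff yE : y x = (2^-1)%:C *: (b x + y (y x)).
  have half : (2^-1)%:C + (2^-1)%:C = 1 :> R[i].
    by rewrite -rmorphD /= -[2^-1]mul1r -splitr.
  by rewrite -[RHS]scale1r -half scalerDl -!yE.
apply: fcvg_unique h _ => /=.
apply: (@fcvg_lipschitz (fun z => (2^-1)%:C *: (b x + z)) 1) h2 => u v.
rewrite -scalerBr opprD addrACA subrr add0r fnormZ// ger0_norm ?invr_ge0//.
by rewrite ler_wpM2r ?fnorm_ge0// invf_le1// ler1n.
Qed.

Lemma sqrt_lim_symmetric u v : s (y u) v = s u (y v).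
Proof.
have Ys k : forall u v, s (Y k u) v = s u (Y k v).
  elim: k => [|k ih] u' v' /=; first by rewrite pform0l// pform0r.
  rewrite pformZl// pformZr// conj_realC pformDl // pformDr//.
  by rewrite positive_symmetric !ih.
have yr u' v' : q (y u') v' = q u' (y v').
  apply/eqP; rewrite -subr_eq0 -normr_le0.
  apply/ler_addgt0Pl => e e0; rewrite addr0.
  have c0 : 0 < nrm u' + nrm v' + 1 by rewrite ltr_wpDl// addr_ge0 ?fnorm_ge0.
  have e1 := divr_gt0 e0 c0.
  have [K hK] := sqrt_limP u' e1; have [L hL] := sqrt_limP v' e1.
  set k := maxn K L; have := hK k (leq_maxl _ _); have := hL k (leq_maxr _ _).
  set d := Y k u' - y u'; set d' := Y k v' - y v' => dv du.
  have -> : q (y u') v' - q u' (y v') = q d' u' - q d v'.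
    rewrite /d /d' !(rformE qr) (rformC qr (y v')) (rformC qr (Y k v')).
    have -> : q (Y k u') v' = q u' (Y k v') by rewrite /q Ys.
    by ring.
  have b1 p p' : `|q p p'| <= nrm p * nrm p'.
    by rewrite ler_norml le_fnormM// andbT lerNl -(rformNl qr)
      -(fnormN qp p) le_fnormM.
  apply: le_trans (ler_normB _ _) _.
  have := b1 d' u'; have := b1 d v'.
  have : nrm d' * nrm u' <= e / (nrm u' + nrm v' + 1) * nrm u' by rewrite
    ler_wpM2r ?fnorm_ge0.
  have : nrm d * nrm v' <= e / (nrm u' + nrm v' + 1) * nrm v' by rewrite
    ler_wpM2r ?fnorm_ge0.
  have : e = e / (nrm u' + nrm v' + 1) * nrm u' + e / (nrm u' + nrm v' + 1) *
    nrm v' + e / (nrm u' + nrm v' + 1).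
    by field; rewrite gt_eqF.
  by lra.
(* The real parts agree at every pair; replacing u by - i u gives the
   imaginary parts. *)
have h1 := yr u v.
have := yr (- 'i *: u) v; rewrite /q (lin_scaleE sqrt_lim_linear).
rewrite !(pformZl sp) !ReiM => h2.
by move: h1 h2; rewrite /q;
  case: (s (y u) v) (s u (y v)) => [a d] [a' d'] /= -> ->.
Qed.

Lemma sqrt_lim_commute d c : linear d -> (forall x, nrm (d x) <= c * nrm x) ->
  (forall x, d (b x) = b (d x)) -> forall x, d (y x) = y (d x).
Proof.
move=> dl dc db x; apply: fcvg_unique (sqrt_limP _).
have -> : (fun k => Y k (d x)) = d \o (fun k => Y k x).
  apply/funext => k /=; elim: k x => [|k ih] z /=.
    by rewrite (lin_0E dl).
  by rewrite (lin_scaleE dl) (lin_addE dl) db !ih.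
apply: fcvg_lipschitz (sqrt_limP x) => u v; rewrite -lin_subE//; exact: dc.
Qed.

End SquareRootIteration.

(** * Completeness of finite Hilbert sums *)

Section Completeness.
Context {R : realType}.

Lemma hilbert_geometric_cvg (H : hilbertType R) (u : nat -> H) c r :
  0 <= r < 1 -> (forall k, fnorm rip (u k.+1 - u k) <= c * r ^+ k) ->
  exists l, fcvg (fun x y : H => ⟨x, y⟩) u l.
Proof.
move=> /andP[r0 r1] ur; pose nrm := fnorm (@rip R H).
have c0 : 0 <= c by have := ur 0%N; rewrite expr0 mulr1;
  apply: le_trans (fnorm_ge0 _ _).
have s0 : 0 < 1 - r by rewrite subr_gt0.
have tail k m : nrm (u (k + m)%N - u k) <= c * r ^+ k * (1 - r ^+ m) / (1 - r).
  elim: m => [|m ih].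
    by rewrite addn0 subrr expr0 subrr mulr0 mul0r /nrm fnorm0 ?lexx//;
      case: (@rip_psd R H).
  have -> : u (k + m.+1)%N - u k = (u (k + m).+1 - u (k + m)%N) +
    (u (k + m)%N - u k).
    by rewrite addrA subrK addnS.
  apply: le_trans (fnormD (@rip_psd R H) _ _) _.
  have -> : c * r ^+ k * (1 - r ^+ m.+1) / (1 - r) =
      c * r ^+ (k + m) + c * r ^+ k * (1 - r ^+ m) / (1 - r).
    by rewrite exprD exprS; field; rewrite gt_eqF.
  exact: lerD.
have small e : 0 < e -> exists k, c * r ^+ k / (1 - r) <= e.
  move=> e0; have e1 : 0 < e * (1 - r) / (c + 1).
    by rewrite divr_gt0 ?mulr_gt0// ltr_wpDl.
  have : (fun n => r ^+ n) @ \oo --> (0 : R) by apply: cvg_expr;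
    rewrite ger0_norm.
  move=> /cvgrPdist_le /(_ _ e1)[k _ /(_ k (leqnn k))] /=.
  rewrite sub0r normrN ger0_norm ?exprn_ge0// => hk; exists k.
  rewrite ler_pdivrMr// (le_trans (y := (c + 1) * r ^+ k))//.
    by rewrite ler_wpM2r ?exprn_ge0// lerDl.
  by rewrite mulrC -ler_pdivlMr// ltr_wpDl.
have ucauchy e k : c * r ^+ k / (1 - r) <= e -> forall m, (k <= m)%N ->
  nrm (u m - u k) <= e.
  move=> h m km; apply: le_trans h; rewrite -(subnKC km);
    apply: le_trans (tail _ _) _.
  apply: ler_wpM2r; first by rewrite invr_ge0 ltW.
  rewrite ler_piMr ?mulr_ge0 ?exprn_ge0//.
  by rewrite gerBl exprn_ge0.
have : cvg (u @ \oo).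
  apply/cauchy_cvgP/cauchy_exP => e; case: e => a b;
    rewrite ltcE /= => /andP[/eqP -> a0].
  have a2 : 0 < a / 2 by rewrite divr_gt0.
  have [k /ucauchy hk] := small _ a2.
  exists (u k), k => // m /= /hk h;
    rewrite -ball_normE /ball_ /= distrC norm_fnorm ltcR.
  by apply: le_lt_trans h _; rewrite ltr_pdivrMr// ltr_pMr// ltr1n.
move=> /cvg_ex[l ul]; exists l => e e0.
have ec : 0 < e%:C :> R[i] by rewrite ltcR.
move/cvgrPdist_le : ul => /(_ _ ec)[k _ hk]; exists k => m /hk /=.
by rewrite distrC norm_fnorm lecR.
Qed.

Context {K : hilbertType R} {I : finType}.
Implicit Types xi eta : I -> K.

(** The inner product of the Hilbert sum of copies of K indexed by I. *)
Definition vinner xi eta := \sum_i ⟨xi i, eta i⟩.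

Lemma vinner_positive : positive_form vinner.
Proof.
split=> [c x y z|c x y z|x].
- by rewrite mulr_sumr -big_split; apply: eq_bigr => i _;
  rewrite /= innerDl innerZl.
- by rewrite mulr_sumr -big_split; apply: eq_bigr => i _;
  rewrite /= innerDr innerZr.
- by apply: sumr_ge0 => i _; exact: inner_ge0.
Qed.

Lemma vinner_eq0 xi : vinner xi xi = 0 -> xi = 0.
Proof.
move=> /eqP; rewrite psumr_eq0 => [/allP h|i _]; last exact: inner_ge0.
by apply/funext => i; apply/inner_eq0/eqP; apply: h; rewrite mem_index_enum.
Qed.

Let nrm : (I -> K) -> R := fnorm (fun x y => Re (vinner x y)).

Lemma vinner_sqr xi : Re (vinner xi xi) = \sum_i rip (xi i) (xi i).
Proof. exact: Re_sum. Qed.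

Lemma le_fnorm_vinner xi i : fnorm rip (xi i) <= nrm xi.
Proof.
rewrite /nrm /fnorm ler_wsqrtr// vinner_sqr (bigD1 i)//= lerDl.
by apply: sumr_ge0 => j _; exact: (psd_ge0 rip_psd).
Qed.

Lemma fnorm_vinner_le xi e : 0 <= e -> (forall i, fnorm rip (xi i) <= e) ->
  nrm xi <= Num.sqrt #|I|%:R * e.
Proof.
move=> e0 h; rewrite /nrm /fnorm -[e](ger0_norm e0) -sqrtr_sqr -sqrtrM ?ler0n//.
apply: ler_wsqrtr; rewrite vinner_sqr mulr_natl -sumr_const;
  apply: ler_sum => i _.
by rewrite -(fnorm_sqr rip_psd) lerXn2r ?nnegrE ?fnorm_ge0.
Qed.

Lemma vinner_geometric_cvg (u : nat -> I -> K) c r : 0 <= r < 1 ->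
  (forall k, nrm (u k.+1 - u k) <= c * r ^+ k) -> exists l, fcvg vinner u l.
Proof.
move=> r01 ur.
have /choice[l ul] : forall i, exists l, fcvg (fun x y : K => ⟨x, y⟩)
  (fun k => u k i) l.
  move=> i; apply: (hilbert_geometric_cvg (c := c) r01) => k.
  by apply: le_trans (ur k); exact: (le_fnorm_vinner (u k.+1 - u k)).
exists l => e e0; have c0 : 0 < Num.sqrt #|I|%:R + 1 :> R by rewrite
  ltr_wpDl ?sqrtr_ge0.
have e1 := divr_gt0 e0 c0.
have /choice[k hk] := fun i => ul i _ e1.
exists (\max_i k i) => m km; apply: le_trans (fnorm_vinner_le (ltW e1) _) _.
  by move=> i; apply: (hk i); apply: leq_trans km; exact: leq_bigmax.
rewrite mulrA ler_pdivrMr// mulrC; apply: ler_wpM2l; first exact: ltW.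
by rewrite lerDl.
Qed.

End Completeness.

(** * Matrices over a von Neumann algebra *)

Section BoundedOperators.
Context {R : realType} {H : hilbertType R}.
Implicit Types a : H -> H.

Lemma bounded_op_bound a : bounded_op a ->
  exists2 c : R, 0 < c & forall x, fnorm rip (a x) <= c * fnorm rip x.
Proof.
move=> [al ac]; pose L := GRing.isLinear.Build _ _ _ _ a al.
pose f : {linear H -> H} := HB.pack a L.
have /linear_bounded_continuous/linear_boundedP : continuous f by [].
move=> /pinfty_ex_gt0[c c0 h]; exists (Re c).
  by move: c0; rewrite ltcE => /andP[].
move=> x; have := h x; rewrite !norm_fnorm (ge0_ReE (ltW c0)) -rmorphM /=.
by rewrite lecR.
Qed.

Lemma bound_bounded_op a (c : R) : linear a ->
  (forall x, fnorm rip (a x) <= c * fnorm rip x) -> bounded_op a.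
Proof.
move=> al h; split=> //; pose L := GRing.isLinear.Build _ _ _ _ a al.
pose f : {linear H -> H} := HB.pack a L.
suff : continuous f by [].
apply: bounded_linear_continuous; apply/linear_boundedP.
exists c%:C; split=> [|e ce x]; first by apply/complex_realP; exists c.
rewrite !norm_fnorm; apply: le_trans (_ : (c * fnorm rip x)%:C <= _).
  by rewrite lecR; exact: h.
by rewrite rmorphM /= ler_wpM2r ?ler0c ?fnorm_ge0 ?ltW.
Qed.

End BoundedOperators.

Section VNMatrices.
Context {R : realType} {K : hilbertType R} {M : vnAlgebra K}.

Lemma vn_bounded (a : M) : bounded_op a.
Proof. by have := vn_valP a; rewrite /vn_pred inE -vn_bicommutant => -[]. Qed.

Lemma vn_linear (a : M) : linear a. Proof. by case: (vn_bounded a). Qed.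

Lemma vn_addE (a b : M) x : (a + b) x = a x + b x. Proof. by []. Qed.

Lemma vn_scaleE c (a : M) x : (c *: a) x = c *: a x. Proof. by []. Qed.

Lemma vn_sumE (I : Type) (s : seq I) (F : I -> M) x :
  (\sum_(i <- s) F i) x = \sum_(i <- s) F i x.
Proof. exact: (big_morph (fun a : M => a x) (fun a b => vn_addE a b x)). Qed.

Lemma vn_eqP (a b : M) : (forall x, a x = b x) -> a = b.
Proof. by move=> h; apply: val_inj; apply/funext. Qed.

Lemma vn_starE (a b : M) : is_adjoint a b -> vn_star a = b.
Proof.
move=> ab; apply: vn_eqP => x; apply: innerI => z.
by rewrite (inner_conj z (vn_star a x)) -vn_starP ab (inner_conj z (b x)).
Qed.

Lemma vn_id_subproof : (id : K -> K) \in vn_pred M.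
Proof.
rewrite /vn_pred inE -vn_bicommutant; split=> //.
by split=> // x; exact: cvg_id.
Qed.

Definition vn_one : M := VNElt vn_id_subproof.

Context {I : finType}.
Implicit Types (a : I -> I -> M) (xi eta : I -> K).

Local Notation nrm := (fnorm (fun xi eta => Re (vinner xi eta))).

Definition mxact a xi i := \sum_j a i j (xi j).

Lemma positive_mxP a : positive_mx a <-> forall xi, 0 <= vinner (mxact a xi) xi.
Proof.
have e xi : vinner (mxact a xi) xi = \sum_i \sum_j ⟨a i j (xi j), xi i⟩.
  by apply: eq_bigr => i _; rewrite inner_suml.
by split=> h xi; have := h xi; rewrite e.
Qed.

Lemma mxact_linear a : linear (mxact a).
Proof.
move=> c x y; apply/funext => i; rewrite /mxact !fctE scaler_sumr -big_split.
by apply: eq_bigr => j _; rewrite /= vn_linear.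
Qed.

Lemma mxact_bound a : exists2 c, 0 < c & forall xi, nrm (mxact a
  xi) <= c * nrm xi.
Proof.
have /choice[c hc] : forall ij : I * I, exists c, 0 < c /\
    forall x, fnorm rip (a ij.1 ij.2 x) <= c * fnorm rip x.
  by move=> ij; have [c] := bounded_op_bound (vn_bounded (a
    ij.1 ij.2)); exists c.
pose C := \sum_ij c ij.
have C0 : 0 <= C by apply: sumr_ge0 => ij _; case: (hc ij) => /ltW.
exists (Num.sqrt #|I|%:R * (#|I|%:R * C) + 1) => [|xi].
  by rewrite ltr_wpDl// !mulr_ge0 ?sqrtr_ge0.
apply: (@le_trans _ _ (Num.sqrt #|I|%:R * (#|I|%:R * C) * nrm xi)); last first.
  by rewrite ler_wpM2r ?fnorm_ge0// lerDl.
rewrite -mulrA; apply: fnorm_vinner_le => [|i].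
  by rewrite !mulr_ge0 ?fnorm_ge0.
rewrite -mulrA mulr_natl -sumr_const.
have nsum (F : I -> K) : fnorm rip (\sum_j F j) <= \sum_j fnorm rip (F j).
  elim/big_rec2 : _ => [|j y z _ h]; first by rewrite fnorm0 //;
    case: (@rip_psd R K).
  by apply: le_trans (fnormD rip_psd _ _) _; rewrite lerD2l.
apply: le_trans (nsum _) _; apply: ler_sum => j _.
have [c0 /(_ (xi j))] := hc (i, j); move/le_trans; apply; apply: ler_pM.
- exact: ltW.
- exact: fnorm_ge0.
- rewrite /C (bigD1 (i, j))//= lerDl; apply: sumr_ge0 => ij _.
  by case: (hc ij) => /ltW.
- exact: le_fnorm_vinner.
Qed.

Definition inj_at j (x : K) : I -> K := fun k => if k == j then x else 0.

Lemma inj_at_linear j : linear (inj_at j).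
Proof.
move=> c x y; apply/funext => k; rewrite !fctE /inj_at.
by case: ifP => _ //; rewrite scaler0 addr0.
Qed.

Lemma sum_inj_at xi : \sum_j inj_at j (xi j) = xi.
Proof.
apply/funext => k; rewrite fct_sumE (bigD1 k)//= {1}/inj_at eqxx big1 ?addr0//.
by move=> j; rewrite /inj_at eq_sym => /negPf ->.
Qed.

Lemma vinner_inj_at xi j x : vinner xi (inj_at j x) = ⟨xi j, x⟩.
Proof.
rewrite /vinner (bigD1 j)//= {1}/inj_at eqxx big1 ?addr0// => k /negPf.
by rewrite /inj_at => ->; rewrite inner0r.
Qed.

Lemma vinner_inj_at_l xi j x : vinner (inj_at j x) xi = ⟨x, xi j⟩.
Proof. by rewrite (pform_conj vinner_positive) vinner_inj_at -inner_conj. Qed.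

Lemma mxact_inj_at a i j x : mxact a (inj_at j x) i = a i j x.
Proof.
rewrite /mxact (bigD1 j)//= {1}/inj_at eqxx big1 ?addr0// => k /negPf.
by rewrite /inj_at => ->; rewrite (lin_0E (vn_linear _)).
Qed.

Lemma fnorm_inj_at j x : nrm (inj_at j x) = fnorm rip x.
Proof. by rewrite /fnorm vinner_inj_at /inj_at eqxx. Qed.

(** The entries of G commute with the commutant of M, so they lie in the
    bicommutant, which is M. *)
Lemma mx_of_commuting (G : (I -> K) -> I -> K) c : linear G ->
  (forall xi, nrm (G xi) <= c * nrm xi) ->
  (forall d, commutant (vn_set M) d -> forall xi, d \o G xi = G (d \o xi)) ->
  exists m : I -> I -> M, G = mxact m.
Proof.
move=> Gl Gc Gd; pose g i j x := G (inj_at j x) i.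
have gM i j : g i j \in vn_pred M.
  rewrite /vn_pred inE -vn_bicommutant; split.
    apply: (bound_bounded_op (c := c)) => [k x y|x].
      by rewrite /g inj_at_linear Gl.
    apply: le_trans (le_fnorm_vinner _ _) _; apply: le_trans (Gc _) _.
    by rewrite fnorm_inj_at.
  move=> d dM; apply/funext => x /=; rewrite /g.
  have := congr1 (@^~ i) (Gd d dM (inj_at j x)); rewrite /= => ->.
  have [[dl _] _] := dM; congr (G _ i); apply/funext => k /=.
  by rewrite /inj_at; case: ifP => // _; rewrite lin_0E.
exists (fun i j => VNElt (gM i j)); apply/funext => xi; apply/funext => i.
by rewrite -{1}(sum_inj_at xi) (lin_sumE Gl) fct_sumE.
Qed.

End VNMatrices.

(** * Positive matrices and Gram matrices *)

Section PositiveMatrices.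
Context {R : realType} {K : hilbertType R} {M : vnAlgebra K} {I : finType}.
Implicit Types a : I -> I -> M.

Local Notation vip := (@vinner R K I).
Local Notation nrm := (fnorm (fun xi eta => Re (vip xi eta))).

Definition gram (x : I -> M) : I -> I -> M :=
  fun i j => vn_mul (vn_star (x i)) (x j).

Definition mx_one : I -> I -> M := fun i j => if i == j then vn_one else 0.

Lemma mxact_one xi : mxact mx_one xi = xi.
Proof.
apply/funext => i; rewrite /mxact (bigD1 i)//= big1 ?addr0 => [|j /negPf].
  by rewrite /mx_one eqxx.
by rewrite /mx_one eq_sym => ->.
Qed.

Lemma mxactD a b xi : mxact (a + b) xi = mxact a xi + mxact b xi.
Proof.
apply/funext => i.
transitivity (\sum_j a i j (xi j) + \sum_j b i j (xi j)) => //.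
by rewrite -big_split.
Qed.

Lemma mxactZ c a xi : mxact (c *: a) xi = c *: mxact a xi.
Proof.
apply/funext => i; transitivity (c *: \sum_j a i j (xi j)) => //.
by rewrite scaler_sumr.
Qed.

Lemma mxact_inj a b : (forall xi, mxact a xi = mxact b xi) -> a = b.
Proof.
move=> h; apply/funext => i; apply/funext => j; apply: vn_eqP => x.
by rewrite -!mxact_inj_at h.
Qed.

(** For e > 0 the operator T = a + e is bounded below, so b = 1 - T / s satisfies
    0 <= b <= 1 - e / s < 1 when s is large, and the iteration gives a selfadjoint
    g with g^2 = T / s. It commutes with the diagonal action of the commutant of M
    because a does, so g is a matrix m over M, and g^2 = g^* g. *)
Lemma positive_mx_factor a (e : R) : positive_mx a -> 0 < e ->
  exists (s : R) (m : I -> I -> M), 0 < s /\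
    a + e%:C *: mx_one = s%:C *: \sum_k gram (m k).
Proof.
move=> /positive_mxP a0 e0; have [c c0 ac] := mxact_bound a.
(* The scale s bounds a + e, whence b >= 0. *)
pose s := c + e; have s0 : 0 < s by rewrite addr_gt0.
pose T := mxact (a + e%:C *: mx_one); have Tl : linear T := mxact_linear _.
have TE xi : T xi = mxact a xi + e%:C *: xi by rewrite /T
  mxactD mxactZ mxact_one.
pose b xi := xi - (s^-1)%:C *: T xi.
have vp := @vinner_positive R K I; have qp := positive_form_psd vp.
have bl : linear b.
  move=> k x y; rewrite /b Tl !(scalerBr, scalerDr) opprD addrACA;
    congr (_ - _ + _).
  by rewrite !scalerA mulrC.
pose v xi := Re (vip xi xi); pose w xi := Re (vip (mxact a xi) xi).
have bE xi : vip (b xi) xi = (v xi - s^-1 * (w xi + e * v xi))%:C.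
  rewrite /b TE -scaleNr (pformDl vp) (pformZl vp) (pformDl vp) (pformZl vp).
  rewrite (pform_diagE vp) (ge0_ReE (a0 xi)) -/(v xi) -/(w xi).
  by rewrite rmorphB rmorphM rmorphD rmorphM mulNr.
have v0 xi : 0 <= v xi by exact: (psd_ge0 qp).
have w0 xi : 0 <= w xi by exact/Re_ge0/a0.
have wv xi : w xi <= c * v xi.
  have -> : v xi = nrm xi ^+ 2 by rewrite (fnorm_sqr qp).
  apply: le_trans (le_fnormM qp _ _) _; rewrite expr2 mulrA.
  by rewrite ler_wpM2r ?fnorm_ge0.
have b0 xi : 0 <= vip (b xi) xi.
  rewrite bE ler0c subr_ge0 mulrC ler_pdivrMr// [leRHS]mulrC /s mulrDl.
  by rewrite lerD2r.
have br xi : Re (vip (b xi) xi) <= (1 - e / s) * v xi.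
  rewrite bE /= mulrBl mul1r lerD2l lerN2 [s^-1 * _]mulrC mulrAC.
  by rewrite ler_wpM2r ?invr_ge0 ?(ltW s0)// lerDr.
have r01 : 0 <= 1 - e / s < 1.
  rewrite subr_ge0 ltrBlDr ltrDl divr_gt0// andbT ler_pdivrMr// mul1r.
  by rewrite /s lerDr ltW.
have cmp := @vinner_geometric_cvg R K I.
pose y := sqrt_lim vp cmp bl b0 br r01.
have yl : linear y by apply: sqrt_lim_linear; exact: vinner_eq0.
pose g xi := xi - y xi.
have gl : linear g.
  by move=> k x z; rewrite /g yl !scalerBr opprD addrACA.
have [|d dM xi|m gm] := @mx_of_commuting R K M I g 2 gl.
- move=> xi; apply: le_trans (fnormB qp _ _) _; rewrite mulr_natl mulr2n lerD2l.
  apply: le_trans (sqrt_lim_le _ _ _ _ _ _ _) _.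
  by have /andP[_ /ltW r1] := r01; rewrite ler_piMl ?fnorm_ge0.
- have [db dc] := dM; have [dl _] := db; have [k k0 dk] := bounded_op_bound db.
  pose D (xi : I -> K) := d \o xi.
  have Dl : linear D by move=> p x z; apply/funext => i; rewrite /D /= !fctE dl.
  have Da eta : D (mxact a eta) = mxact a (D eta).
    apply/funext => i; rewrite /D /mxact /= (lin_sumE dl);
      apply: eq_bigr => j _.
    have /(congr1 (@^~ (eta j))) := dc (a i j) (set_mem (vn_valP _)).
    by move=> /= ->.
  have Db eta : D (b eta) = b (D eta).
    by rewrite /b !TE (lin_subE Dl) (lin_scaleE Dl) (lin_addE Dl)
      (lin_scaleE Dl) Da.
  have Dk eta : nrm (D eta) <= k * nrm eta.
    rewrite /fnorm -[k](ger0_norm (ltW k0)) -sqrtr_sqr -sqrtrM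
      ?sqr_ge0// ler_wsqrtr//.
    rewrite !vinner_sqr mulr_sumr; apply: ler_sum => i _.
    rewrite -!(fnorm_sqr rip_psd) -exprMn; apply: lerXn2r.
    - exact: fnorm_ge0.
    - by rewrite nnegrE mulr_ge0 ?fnorm_ge0// ltW.
    - exact: dk.
  have := sqrt_lim_commute vp (@vinner_eq0 _ _ _) cmp bl b0 br r01 Dl Dk Db xi.
  by rewrite -/y -/(D (g xi)) -/(D xi) /g (lin_subE Dl) => ->.
exists s, m; split=> //; apply: mxact_inj => xi.
have gs u v' : vip (g u) v' = vip u (g v').
  have ys : vip (y u) v' = vip u (y v').
    exact: (sqrt_lim_symmetric vp (@vinner_eq0 _ _ _)).
  by rewrite /g (pformDl vp) (pformDr vp) (pformNl vp) (pformNr vp) ys.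
have ms i j : vn_star (m i j) = m j i.
  apply: vn_starE => x z;
    rewrite -(mxact_inj_at m i j x) -(mxact_inj_at m j i z) -gm.
  have := gs (inj_at j x) (inj_at i z).
  by rewrite vinner_inj_at vinner_inj_at_l.
have gg : g (g xi) = (s^-1)%:C *: T xi.
  have gE : g (g xi) = xi - (y xi + y xi - y (y xi)).
    by rewrite /g (lin_subE yl) !opprD !opprK !addrA.
  have -> := gE; have := sqrt_limE vp (@vinner_eq0 _ _ _) cmp bl b0 br r01 xi.
  by rewrite -/y => ->; rewrite addrK /b opprB addrC subrK.
rewrite mxactZ.
have sumE : mxact (\sum_k gram (m k)) xi = mxact m (mxact m xi).
  apply/funext => i; rewrite /mxact.
  under [LHS]eq_bigr => j _ do rewrite !fct_sumE vn_sumE.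
  rewrite exchange_big; apply: eq_bigr => k _.
  by rewrite (lin_sumE (vn_linear _)); apply: eq_bigr => j _;
    rewrite /gram /= ms.
by rewrite sumE -gm gg scalerA -rmorphM mulfV ?gt_eqF// scale1r.
Qed.

(** Up to an arbitrarily small multiple of the identity, a positive matrix is a
    positive multiple of a sum of Gram matrices. *)
Lemma positive_mx_ind (phi : (I -> I -> M) -> R[i]) :
  (forall c a b, phi (c *: a + b) = c * phi a + phi b) ->
  (forall x, 0 <= phi (gram x)) ->
  forall a, positive_mx a -> 0 <= phi a.
Proof.
move=> phil phi0 a a_ge0.
have phiD a' b' : phi (a' + b') = phi a' + phi b'.
  by rewrite -[a']scale1r phil mul1r scale1r.
have phi00 : phi 0 = 0 by apply: (addrI (phi 0)); rewrite -phiD !addr0.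
have phiZ c a' : phi (c *: a') = c * phi a'.
  by rewrite -[c *: a']addr0 phil phi00 addr0.
have h (e : R) : 0 < e -> 0 <= phi a + e%:C * phi mx_one.
  move=> e0; have [s [m [s0 fact]]] := positive_mx_factor a_ge0 e0.
  rewrite -phiZ -phiD fact phiZ mulr_ge0 ?ler0c ?(ltW s0)//.
  by rewrite (big_morph phi phiD phi00); apply: sumr_ge0.
have := h 1 ltr01; have := h 2 (ltr0n _ 2).
case: (phi a) (phi mx_one) h => [x y] [z t] h.
move=> /complex_ge0[/= h1 _] /complex_ge0[/= h2 _].
apply/complex_ge0; split=> /=.
  by move: h1 h2; rewrite !mul0r !addr0 mul1r; lra.
apply/ler_addgt0Pr => e e0; have z0 : 0 < `|z| + 1 by rewrite ltr_wpDl.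
have /h/complex_ge0[_ /=] := divr_gt0 e0 z0; rewrite mul0r subr0
  => /le_trans; apply.
rewrite lerD2l mulrAC ler_pdivrMr// ler_pM2l//.
by apply: le_trans (ler_norm z) _; rewrite lerDl.
Qed.

End PositiveMatrices.

(** * Transfer of positivity along star-homomorphisms *)

Section GramMatrices.
Context {R : realType} {K : hilbertType R} {M : vnAlgebra K}.

Lemma vn_star_adjoint (a : M) x y : ⟨vn_star a x, y⟩ = ⟨x, a y⟩.
Proof. by rewrite inner_conj -vn_starP -inner_conj. Qed.

Lemma gram_quadratic (I : finType) (x : I -> M) (xi : I -> K) :
  \sum_i \sum_j ⟨gram x i j (xi j), xi i⟩ =
  ⟨\sum_j x j (xi j), \sum_i x i (xi i)⟩.
Proof.
rewrite inner_sumr; apply: eq_bigr => i _; rewrite inner_suml.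
by apply: eq_bigr => j _; rewrite /= vn_star_adjoint.
Qed.

Lemma gram_positive (I : finType) (x : I -> M) : positive_mx (gram x).
Proof. by move=> xi; rewrite gram_quadratic inner_ge0. Qed.

End GramMatrices.

Section StarHomomorphisms.
Context {R : realType} {K L : hilbertType R} {M : vnAlgebra K}
  {N : vnAlgebra L}.

Lemma quadratic_linear (I J : finType) (F : J -> J -> (I -> I -> M) -> N)
    (xi : J -> L) : (forall p q, linear (F p q)) -> forall c a b,
  \sum_p \sum_q ⟨F p q (c *: a + b) (xi q), xi p⟩ =
  c * (\sum_p \sum_q ⟨F p q a (xi q), xi p⟩) + \sum_p \sum_q ⟨F p
    q b (xi q), xi p⟩.
Proof.
move=> Fl c a b; rewrite mulr_sumr -big_split; apply: eq_bigr => p _ /=.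
rewrite mulr_sumr -big_split; apply: eq_bigr => q _ /=.
by rewrite Fl vn_addE vn_scaleE innerDl innerZl.
Qed.

(** A star-homomorphism maps Gram matrices to Gram matrices. *)
Lemma star_hom_positive (rho : M -> N) : linear rho ->
  (forall a b, rho (vn_mul a b) = vn_mul (rho a) (rho b)) ->
  (forall a, rho (vn_star a) = vn_star (rho a)) ->
  forall (I : finType) (a : I -> I -> M), positive_mx a ->
    positive_mx (fun i j => rho (a i j)).
Proof.
move=> rl rm rs I a a0 xi.
pose phi (a : I -> I -> M) := \sum_i \sum_j ⟨rho (a i j) (xi j), xi i⟩.
apply: (@positive_mx_ind _ _ _ _ phi) a0 => [|x].
  by apply: (quadratic_linear (F := fun i j a => rho (a i j))) => i j c b d;
    rewrite rl.
have -> : phi (gram x) = \sum_i \sum_j ⟨gram (rho \o x) i j (xi j), xi i⟩.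
  by do 2!apply: eq_bigr => ? _; rewrite /gram rm rs.
exact: (gram_positive (rho \o x) xi).
Qed.

End StarHomomorphisms.

Section StandardRepresentation.
Context {R : realType} {L : hilbertType R} {N : vnAlgebra L} (F
  : standardForm N).

(** The representation is bijective, and its inverse is a star-homomorphism too. *)
Lemma std_positive (I : finType) (a : I -> I -> N) :
  positive_mx (fun i j => std_rep F (a i j)) <-> positive_mx a.
Proof.
split; last first.
  by apply: star_hom_positive;
    [exact: std_rep_linear|exact: std_rep_mul|exact: std_rep_star].
have [rho rK Kr] := std_rep_bij F; have ri := can_inj rK.
have h : positive_mx (fun i j => std_rep F (a i j)) ->
    positive_mx (fun i j => rho (std_rep F (a i j))).
  apply: (star_hom_positive (rho := rho)) => [c x y|x y|x]; apply: ri.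
  - by rewrite std_rep_linear !Kr.
  - by rewrite std_rep_mul !Kr.
  - by rewrite std_rep_star !Kr.
move=> /h; congr (positive_mx _).
by apply/funext => i; apply/funext => j; rewrite rK.
Qed.

End StandardRepresentation.

(** * Elementary tensors span the algebraic tensor product *)

Section TensorSpan.
Context {C : fieldType} {X Y V : lmodType C} (t : {bilinear X -> Y -> V}).

Definition tsum (s : seq (X * Y)) : V := \sum_(p <- s) t p.1 p.2.

Definition tspan_pred : {pred V} := fun v => `[< exists s, v = tsum s >].

Lemma tspan_submod : submod_closed tspan_pred.
Proof.
split=> [|c u v].
  by apply/asboolP; exists [::]; rewrite /tsum big_nil.
move=> /asboolP[s ->] /asboolP[s' ->]; apply/asboolP.
exists ([seq (c *: p.1, p.2) | p <- s] ++ s').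
rewrite /tsum big_cat big_map scaler_sumr; congr (_ + _).
by apply: eq_bigr => p _; rewrite /= linearZl_LR.
Qed.

HB.instance Definition _ :=
  GRing.isSubmodClosed.Build C V tspan_pred tspan_submod.

Record tspan := TSpan { tspan_val :> V; tspan_valP : tspan_val \in tspan_pred }.

HB.instance Definition _ := [isSub for tspan_val].
HB.instance Definition _ := [Choice of tspan by <:].
HB.instance Definition _ := [SubChoice_isSubLmodule of tspan by <:].

Lemma tensor_in_span x y : t x y \in tspan_pred.
Proof. by apply/asboolP; exists [:: (x, y)]; rewrite /tsum big_seq1. Qed.

Definition corestricted_tensor x y : tspan := TSpan (tensor_in_span x y).

Lemma corestricted_bilinear :
  bilinear_for *:%R *:%R (corestricted_tensor : X -> Y -> tspan).
Proof.
by split=> [y|x] c u v; apply: val_inj; rewrite /= ?linearPl ?linearPr.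
Qed.

Hypothesis ht : is_tensor_product t.

(** The universal property, applied to the span S of the elementary tensors,
    gives a map g from V to S; followed by the inclusion of S it agrees with the
    identity on elementary tensors, so it is the identity and S = V. *)
Lemma tensor_spanned v : exists s, v = tsum s.
Proof.
pose bB := bilinear_isBilinear.Build C X Y tspan _ _ _ corestricted_bilinear.
pose b : {bilinear X -> Y -> tspan} := HB.pack corestricted_tensor bB.
have [g [gt _]] := ht b.
have [i [it iu]] := ht t.
pose gv : V -> V := fun v => tspan_val (g v).
have gvl : linear gv by move=> c u w; rewrite /gv linearP.
pose gvL := GRing.isLinear.Build _ _ _ _ gv gvl.
pose gL : {linear V -> V} := HB.pack gv gvL.
have h1 : gL =1 i by apply: iu => x y; rewrite /= /gv gt.
have h2 : (idfun : {linear V -> V}) =1 i by apply: iu.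
have -> : v = g v by rewrite -[LHS]/(idfun v) h2 -h1.
by have /asboolP := tspan_valP (g v).
Qed.

Lemma tensor_ext (W : lmodType C) (f g : V -> W) : linear f -> linear g ->
  (forall x y, f (t x y) = g (t x y)) -> f =1 g.
Proof.
move=> fl gl h v; have [s ->] := tensor_spanned v.
by rewrite (lin_sumE fl) (lin_sumE gl); apply: eq_bigr => p _.
Qed.

End TensorSpan.

(** * The sesquilinear form of a completely positive map *)

Section CPForms.
Context {R : realType} {K L : hilbertType R}.
Context {M : vnAlgebra K} {N : vnAlgebra L} (F : standardForm N).
Context {V : lmodType R[i]} (t : {bilinear M -> L2 F -> V}).
Hypothesis ht : is_tensor_product t.
Implicit Types Theta : M -> N.

Lemma vn_star_semilinear c (a b : M) :
  vn_star (c *: a + b) = Num.conj c *: vn_star a + vn_star b.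
Proof.
apply: vn_starE => x y; rewrite !vn_addE !vn_scaleE innerDl innerZl.
by rewrite innerDr innerZr !vn_starP conjCK.
Qed.

Lemma vn_mul_linearl (a : M) : linear (fun b : M => vn_mul b a).
Proof. by move=> c b d; apply: vn_eqP => x. Qed.

Lemma vn_mul_linearr (a : M) : linear (fun b : M => vn_mul a b).
Proof. by move=> c b d; apply: vn_eqP => x; rewrite /= (vn_linear a). Qed.

Definition cp_kernel Theta (x : M) (xi : L2 F) (y : M) (eta : L2 F) : R[i] :=
  ⟨std_rep F (Theta (vn_mul (vn_star y) x)) xi, eta⟩.

Lemma cp_kernel_gram Theta (I : finType) (x : I -> M) (xi : I -> L2 F) :
  \sum_i \sum_j cp_kernel Theta (x j) (xi j) (x i) (xi i) =
  \sum_i \sum_j ⟨std_rep F (Theta (gram x i j)) (xi j), xi i⟩.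
Proof. by []. Qed.

Section Kernel.
Variable Theta : M -> N.
Hypothesis Theta_linear : linear Theta.

Let T a := std_rep F (Theta a).

Let Tl : linear T.
Proof. by move=> c a b; rewrite /T Theta_linear std_rep_linear. Qed.

Lemma cp_kernel_bilinear y eta :
  bilinear_for *:%R *:%R (fun x xi => cp_kernel Theta x xi y eta : R[i]^o).
Proof.
split=> [xi|x] c u v; rewrite /cp_kernel.
  by rewrite vn_mul_linearr -!/(T _) Tl vn_addE vn_scaleE innerDl innerZl.
by rewrite (vn_linear (std_rep F _)) innerDl innerZl.
Qed.

Lemma cp_kernel_semilinearl x xi c y y' eta :
  cp_kernel Theta x xi (c *: y + y') eta =
  Num.conj c * cp_kernel Theta x xi y eta + cp_kernel Theta x xi y' eta.
Proof.
rewrite /cp_kernel vn_star_semilinear vn_mul_linearl -!/(T _) Tl.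
by rewrite vn_addE vn_scaleE innerDl innerZl.
Qed.

Lemma cp_kernel_semilinearr x xi c y eta eta' :
  cp_kernel Theta x xi y (c *: eta + eta') =
  Num.conj c * cp_kernel Theta x xi y eta + cp_kernel Theta x xi y eta'.
Proof. by rewrite /cp_kernel innerDr innerZr. Qed.

(** The universal property is applied once for each variable. In the second one
    the target is the space of functions on V, and conjugation turns
    antilinearity into linearity. *)
Lemma cp_kernel_extension : exists s : V -> V -> R[i],
  [/\ forall z, linear (s^~ z : V -> R[i]^o),
      forall c x y z, s z (c *: x + y) = Num.conj c * s z x + s z y &
      forall x xi y eta, s (t x xi) (t y eta) = cp_kernel Theta x xi y eta].
Proof.
have /choice[g hg] : forall p : M * L2 F, exists g : {linear V -> R[i]^o},
    forall x xi, g (t x xi) = cp_kernel Theta x xi p.1 p.2.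
  move=> [y eta].
  pose bB := bilinear_isBilinear.Build _ _ _ R[i]^o _ _ _
    (cp_kernel_bilinear y eta).
  pose b : {bilinear M -> L2 F -> R[i]^o} :=
    HB.pack (fun x xi => cp_kernel Theta x xi y eta : R[i]^o) bB.
  by have [g [gt _]] := ht b; exists g.
pose G y eta : V -> R[i]^o := fun v => Num.conj (g (y, eta) v).
have gl p : linear (g p) by exact: linearP.
have aux (d k a a' b b' : R[i]) :
    d * (k * a + a') + (k * b + b') = k * (d * a + b) + (d * a' + b') by ring.
have Gb : bilinear_for *:%R *:%R G.
  split=> [eta|y] c u v; apply/funext => w.
    change (Num.conj (g (c *: u + v, eta) w) =
      c * Num.conj (g (u, eta) w) + Num.conj (g (v, eta) w)).
    rewrite -[c in RHS]conjCK -rmorphM -rmorphD; congr Num.conj.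
    pose f z : R[i]^o := Num.conj c * g (u, eta) z + g (v, eta) z.
    apply: (tensor_ext ht (g := f)) => [||x xi]; first exact: gl.
      by move=> k a b; rewrite /f !gl; exact: aux.
    by rewrite /f !hg cp_kernel_semilinearl.
  change (Num.conj (g (y, c *: u + v) w) =
    c * Num.conj (g (y, u) w) + Num.conj (g (y, v) w)).
  rewrite -[c in RHS]conjCK -rmorphM -rmorphD; congr Num.conj.
  pose f z : R[i]^o := Num.conj c * g (y, u) z + g (y, v) z.
  apply: (tensor_ext ht (g := f)) => [||x xi]; first exact: gl.
    by move=> k a b; rewrite /f !gl; exact: aux.
  by rewrite /f !hg cp_kernel_semilinearr.
pose GB := bilinear_isBilinear.Build _ _ _ (V -> R[i]^o) _ _ _ Gb.
pose b : {bilinear M -> L2 F -> (V -> R[i]^o)} := HB.pack G GB.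
have [S [St _]] := ht b.
have StE y eta v : S (t y eta) v = Num.conj (g (y, eta) v) by rewrite St.
exists (fun v w => Num.conj (S w v)); split.
- move=> w; have [l ->] := tensor_spanned ht w; move=> c u v.
  rewrite /tsum !linear_sum !fct_sumE !rmorph_sum scaler_sumr -big_split.
  by apply: eq_bigr => p _; rewrite /= !StE !conjCK linearP.
- by move=> c x y z; rewrite linearP !fctE rmorphD rmorphM.
- by move=> x xi y eta; rewrite StE conjCK hg.
Qed.

End Kernel.

Lemma tensor_decomposition v :
  exists n (x : 'I_n -> M) (xi : 'I_n -> L2 F), v = \sum_i t (x i) (xi i).
Proof.
have [s ->] := tensor_spanned ht v.
exists (size s), (fun i => (tnth (in_tuple s) i).1), (fun i => (tnth
  (in_tuple s) i).2).
by rewrite /tsum (big_tnth _ _ s).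
Qed.

(** Positivity at a sum of elementary tensors is complete positivity on the Gram
    matrix of its left factors. *)
Lemma cp_form_exists Theta : is_cp Theta -> exists s, is_cp_form t Theta s.
Proof.
move=> [Tl Tcp]; have [s [sl sr st]] := cp_kernel_extension Tl.
exists s; split; last by [].
split=> [c x y z|//|v]; first exact: sl.
have [n [x [xi ->]]] := tensor_decomposition v.
have sD z : {morph s z : a b / a + b}.
  by move=> a b; rewrite -[a]scale1r sr rmorph1 mul1r scale1r.
have s0 z : s z 0 = 0 by apply: (addrI (s z 0)); rewrite -sD !addr0.
rewrite (big_morph _ (sD _) (s0 _)).
under eq_bigr => i _ do rewrite (lin_sumE (sl _)).
under eq_bigr => i _ do (under eq_bigr => j _ do rewrite st).
rewrite cp_kernel_gram.
exact: ((std_positive F _).2 (Tcp _ _ (gram_positive x)) xi).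
Qed.

End CPForms.

(** * Spectral measures on a grid *)

Section StepBounds.
Context {R : realType} d (T : measurableType d).
Variable mu : {measure set T -> \bar R}.
Context {J : finType} (Q : J -> set T).
Hypothesis mQ : forall j, measurable (Q j).
Hypothesis tQ : forall i j, Q i `&` Q j !=set0 -> i = j.
Hypothesis cQ : mu (~` \bigcup_j Q j) = 0%E.
Hypothesis muT : (mu setT < +oo)%E.

Let D := \big[setU/set0]_(j <- enum J) Q j.

Let DE : D = \bigcup_j Q j.
Proof.
by rewrite /D -bigcup_seq; apply: eq_bigcupl; split=> j //= _; rewrite mem_enum.
Qed.

Let mD : measurable D.
Proof. by apply: bigsetU_measurable => j _; exact: mQ. Qed.

Let tD : trivIset [set` enum J] Q.
Proof. by move=> i j _ _; exact: tQ. Qed.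

Lemma Rintegral_cells f : mu.-integrable setT (EFin \o f) ->
  \int[mu]_x f x = \sum_j \int[mu]_(x in Q j) f x.
Proof.
move=> fi; rewrite /Rintegral.
rewrite (negligible_integral (N := ~` D)) ?DE//; last first.
  by rewrite -DE; exact: measurableC.
rewrite setTD setCK -DE integral_bigsetU_EFin ?enum_uniq//; last first.
  by apply: (measurable_funS _ (@subsetT _ _)) => //; case/integrableP: fi.
rewrite -sum_fine; first by rewrite big_enum.
move=> j _; apply: integrable_fin_num => //.
exact: integrableS fi.
Qed.

Lemma mass_fin S : measurable S -> mu S \is a fin_num.
Proof.
move=> mS; rewrite ge0_fin_numE//; apply: le_lt_trans muT.
by apply: le_measure; rewrite ?inE.
Qed.

Lemma integrable_cst S (l : R) : measurable S ->
  mu.-integrable S (EFin \o (fun=> l)).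
Proof.
move=> mS; apply: measurable_bounded_integrable => //; last exact: bounded_cst.
by rewrite -ge0_fin_numE// mass_fin.
Qed.

Lemma mass_cells : fine (mu setT) = \sum_j fine (mu (Q j)).
Proof.
have := Rintegral_cells (integrable_cst 1 measurableT).
rewrite Rintegral_cst// mul1r => ->.
by apply: eq_bigr => j _; rewrite Rintegral_cst// mul1r.
Qed.

Lemma step_le_Rintegral f (l : J -> R) : mu.-integrable setT (EFin \o f) ->
  (forall j x, Q j x -> l j <= f x) ->
  \sum_j l j * fine (mu (Q j)) <= \int[mu]_x f x.
Proof.
move=> fi lf; rewrite Rintegral_cells//; apply: ler_sum => j _.
rewrite -Rintegral_cst//; apply: le_Rintegral => //; last exact: lf.
  exact: integrable_cst.
exact: integrableS fi.
Qed.

Lemma Rintegral_le_step f (l : J -> R) : mu.-integrable setT (EFin \o f) ->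
  (forall j x, Q j x -> f x <= l j) ->
  \int[mu]_x f x <= \sum_j l j * fine (mu (Q j)).
Proof.
move=> fi lf; rewrite Rintegral_cells//; apply: ler_sum => j _.
rewrite -Rintegral_cst//; apply: le_Rintegral => //; last exact: lf.
  exact: integrableS fi.
exact: integrable_cst.
Qed.

End StepBounds.

Section Projections.
Context {R : realType} {H : hilbertType R}.
Variable p : H -> H.
Hypothesis pp : projection_op p.

Lemma projection_linear : linear p. Proof. by case: pp => -[]. Qed.

Lemma projection_idem x : p (p x) = p x.
Proof. by case: pp => _ /(congr1 (@^~ x)). Qed.

Lemma projection_rip x y : rip (p x) y = rip (p x) (p y).
Proof. by rewrite /rip; case: pp => _ _ h;
  rewrite -[in LHS](projection_idem x) h. Qed.

Lemma projection_form : psd_form (fun x y => rip (p x) y).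
Proof.
have rr : real_form (@rip R H) by case: (@rip_psd R H).
have pl := projection_linear.
split=> [|x]; last by rewrite projection_rip (psd_ge0 rip_psd).
split=> [x y z|r x y|x y].
- by rewrite (lin_addE pl) (rformDl rr).
- by rewrite (lin_scaleE pl) (rformZl rr).
- by rewrite projection_rip (rformC rr) -projection_rip.
Qed.

End Projections.

Section SpectralMeasures.
Context {R : realType} {H : hilbertType R}.
Variable E : spectralMeasure H.

Let projE S : measurable S -> projection_op (E S) := @spm_projP R H E S.

Lemma spm_mass x S : measurable S -> fine (spm_meas E x S) = rip (E S x) x.
Proof. by move=> mS; rewrite spm_measE. Qed.

Lemma spm_massT x : fine (spm_meas E x setT) = rip x x.
Proof. by rewrite spm_mass// spm_projT. Qed.

Lemma spm_finite x : (spm_meas E x setT < +oo)%E.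
Proof. by rewrite spm_measE// ltry. Qed.

Lemma spm_null S x : measurable S -> spm_meas E x S = 0%E -> E S x = 0.
Proof.
move=> mS; rewrite spm_measE// => -[h]; apply: rip_eq0.
by rewrite -(projection_rip (projE mS)).
Qed.

Lemma spm_disjoint S S' x : measurable S -> measurable S' -> S `&` S' = set0 ->
  E S (E S' x) = 0.
Proof.
move=> mS mS' SS'; have /(congr1 (@^~ x)) /= <- := spm_projI E mS mS'.
by rewrite SS'; apply: spm_null => //; rewrite measure0.
Qed.

(** For y in the range of E S, the measure of y is carried by S, whence
    c' |y|^2 <= (T y, y) <= c |y|^2 and y = 0. This confines the joint spectral
    measure of bounded operators to a bounded set. *)
Lemma spm_bounded f T c c' S : is_spectral_integral E f T -> measurable S ->
  (forall u, rip (T u) u <= c * rip u u) -> c < c' ->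
  (forall p, S p -> c' <= f p) -> forall x, spm_meas E x S = 0%E.
Proof.
move=> ET mS Tc cc' fS x; pose y := E S x.
suff y0 : y = 0.
  by rewrite spm_measE// -/(rip _ _) -/y y0 /rip inner0l.
have [fi Ty] := ET y.
have mSc := measurableC mS.
have := @step_le_Rintegral R _ _ (spm_meas E y) unit (fun=> S) (fun=> mS) _ _
  (spm_finite y) f (fun=> c') fi (fun _ => fS).
have -> : \bigcup_(_ in @setT unit) S = S.
  by apply/seteqP; split=> [p [_ _]//|p Sp]; exists tt.
have -> : spm_meas E y (~` S) = 0%E.
  by rewrite spm_measE// /y spm_disjoint// ?inner0l// setICl.
move=> /(_ _ erefl) h; apply: rip_eq0; apply/eqP.
rewrite eq_le (psd_ge0 rip_psd) andbT.
have {h} : c' * rip y y <= rip (T y) y.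
  rewrite {2}/rip Ty /=; apply: le_trans (h _); last by case; case.
  rewrite (bigD1 tt)//= big1 ?addr0 => [|[]//]; rewrite spm_mass//.
  by rewrite /y projection_idem//; exact: projE.
move=> /le_trans /(_ (Tc y)); rewrite -subr_le0 -mulrBl pmulr_rle0// subr_gt0.
by [].
Qed.

End SpectralMeasures.

Section Cells.
Context {R : realType}.

Definition cell (d : R) n (k : 'I_n * 'I_n) : set (R * R) :=
  `[k.1%:R * d, k.1.+1%:R * d[ `*` `[k.2%:R * d, k.2.+1%:R * d[.

Lemma measurable_cell d n k : measurable (@cell d n k).
Proof. by apply: measurableX. Qed.

Lemma cellP (d : R) n (k : 'I_n * 'I_n) p : cell d k p <->
  [/\ k.1%:R * d <= p.1, p.1 < k.1.+1%:R * d,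
      k.2%:R * d <= p.2 & p.2 < k.2.+1%:R * d].
Proof.
rewrite /cell /= !in_itv /=;
  split=> [[/andP[-> ->] /andP[-> ->]]//|[-> -> -> ->]//].
Qed.

Lemma cell_inj (d : R) n (k l : 'I_n * 'I_n) : 0 < d ->
  cell d k `&` cell d l !=set0 -> k = l.
Proof.
move=> d0 [p [/cellP[a1 a2 a3 a4] /cellP[b1 b2 b3 b4]]].
have lt (i j : nat) x : i%:R * d <= x -> x < j.+1%:R * d -> (i <= j)%N.
  by move=> h1 h2; have := le_lt_trans h1 h2; rewrite ltr_pM2r// ltr_nat.
case: k l a1 a2 a3 a4 b1 b2 b3 b4 => [k k'] [l l'] /= a1 a2 a3 a4 b1 b2 b3 b4.
congr pair; apply/val_inj/anti_leq/andP; split=> /=.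
- exact: lt a1 b2.
- exact: lt b1 a2.
- exact: lt a3 b4.
- exact: lt b3 a4.
Qed.

Lemma cell_index (d x : R) n : 0 <= x -> x < n%:R * d ->
  exists k : 'I_n, k%:R * d <= x < k.+1%:R * d.
Proof.
move=> x0; elim: n => [|n ih]; first by rewrite mul0r ltNge x0.
have [/ih[k hk] _|nx xn] := ltP x (n%:R * d).
  by exists (widen_ord (leqnSn n) k).
by exists ord_max; rewrite nx.
Qed.

Lemma cell_cover (d : R) n (p : R * R) : 0 <= p.1 -> p.1 < n%:R * d ->
  0 <= p.2 -> p.2 < n%:R * d -> exists k : 'I_n * 'I_n, cell d k p.
Proof.
move=> h1 h2 h3 h4; have [k /andP[? ?]] := cell_index h1 h2.
by have [l /andP[? ?]] := cell_index h3 h4; exists (k, l); apply/cellP.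
Qed.

End Cells.

Section SpectralGrid.
Context {R : realType} {H : hilbertType R}.
Implicit Types (A B T : H -> H).

Lemma bounded_op_quadratic A : bounded_op A ->
  exists2 c : R, 0 < c & forall u, rip (A u) u <= c * rip u u.
Proof.
move=> /bounded_op_bound[c c0 h]; exists c => // u.
apply: le_trans (le_fnormM rip_psd _ _) _.
by rewrite -(fnorm_sqr rip_psd) expr2 mulrA ler_wpM2r ?fnorm_ge0.
Qed.

Definition step_approx (J : finType) (P : J -> H -> H) (w : J -> R) T (e : R) :=
  forall u, rip (T u) u <= \sum_j w j * rip (P j u) u <= rip (T
    u) u + e * rip u u.

Lemma spectral_step (E : spectralMeasure H) (J : finType) (Q : J -> set (R * R))
    (f : R * R -> R) T (w : J -> R) e :
  (forall j, measurable (Q j)) ->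
  (forall i j, Q i `&` Q j !=set0 -> i = j) ->
  (forall u, spm_meas E u (~` \bigcup_j Q j) = 0%E) ->
  is_spectral_integral E f T ->
  (forall j p, Q j p -> f p <= w j <= f p + e) ->
  step_approx (fun j => E (Q j)) w T e.
Proof.
move=> mQ tQ cQ fT fw u; have [fi Tu] := fT u.
have mass j : fine (spm_meas E u (Q j)) = rip (E (Q j) u) u by rewrite spm_mass.
have -> : rip (T u) u = \int[spm_meas E u]_p f p by rewrite /rip Tu.
have s1 := Rintegral_le_step mQ tQ (cQ u) (spm_finite E u) fi
  (fun j p h => proj1 (andP (fw j p h))).
have s2 := @step_le_Rintegral _ _ _ _ _ _ mQ tQ (cQ u) (spm_finite E u) _
  (fun j => w j - e) fi.
apply/andP; split.
  by apply: le_trans s1 _; under eq_bigr do rewrite mass.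
rewrite -lerBlDr -(spm_massT E) (mass_cells mQ tQ (cQ u) (spm_finite E u)).
rewrite mulr_sumr -sumrB; apply: le_trans (s2 _).
  by apply: ler_sum => j _; rewrite mass mulrBl.
by move=> j p /fw/andP[_]; rewrite lerBlDr.
Qed.

(** The coefficients are the upper right corners of the cells, which makes them
    positive and the approximations one-sided. *)
Lemma spectral_grid A B T (E : spectralMeasure H) (e : R) : 0 < e ->
  bounded_op A -> bounded_op B -> joint_spectral_measure A B E ->
  is_spectral_integral E (fun p => Num.sqrt (p.1 * p.2)) T ->
  exists (J : finType) (P : J -> H -> H) (a b : J -> R),
  [/\ forall j, projection_op (P j),
      forall i j, i != j -> forall u, P i (P j u) = 0,
      forall u, \sum_j P j u = u,
      forall j, 0 < a j /\ 0 < b j &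
      [/\ step_approx P a A e, step_approx P b B e &
          step_approx P (fun j => Num.sqrt (a j * b j)) T e]].
Proof.
move=> e0 bA bB [Epos EA EB] ET.
have [cA cA0 hA] := bounded_op_quadratic bA.
have [cB cB0 hB] := bounded_op_quadratic bB.
pose c := cA + cB + 1; have c0 : 0 < c by rewrite !addr_gt0.
(* The grid has mesh d = c / n and covers [0, c[^2. Moving a point of it to the
   corner of its cell changes p1 p2 by at most d (3 c), which must not exceed
   e^2 for the square root to change by at most e. *)
pose n := Num.bound (3 * c ^+ 2 / e ^+ 2 + c / e).
have p1 : 0 <= 3 * c ^+ 2 / e ^+ 2 by rewrite divr_ge0 ?sqr_ge0//
  mulr_ge0 ?sqr_ge0 ?ler0n.
have p2 : 0 < c / e by rewrite divr_gt0.
have nb : 3 * c ^+ 2 / e ^+ 2 + c / e < n%:R.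
  by apply: archi_boundP; rewrite addr_ge0// ltW.
have n0 : 0 < n%:R :> R by apply: lt_trans nb; rewrite ltr_wpDl.
pose d := c / n%:R; have d0 : 0 < d by rewrite divr_gt0.
have nd : n%:R * d = c by rewrite /d mulrC divfK// gt_eqF.
have de : d <= e.
  rewrite /d ler_pdivrMr// mulrC -ler_pdivrMr// ltW//.
  by apply: le_lt_trans nb; rewrite lerDr.
have dc : d <= c.
  by rewrite /d ler_pdivrMr// ler_peMr ?(ltW c0)// ler1n -(ltr0n R).
have d2 : d * (3 * c) <= e ^+ 2.
  have -> : d * (3 * c) = 3 * c ^+ 2 / n%:R by rewrite /d; field;
    rewrite gt_eqF.
  rewrite ler_pdivrMr// -ler_pdivrMl ?exprn_gt0// [leLHS]mulrC.
  by apply/ltW/(le_lt_trans _ nb); rewrite lerDl ltW.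
pose Q := @cell R d n; pose J := ('I_n * 'I_n)%type.
have mQ : forall j : J, measurable (Q j) by move=> j; exact: measurable_cell.
have tQ : forall i j : J, Q i `&` Q j !=set0 -> i = j by move=> i j;
  exact: cell_inj.
have mP : measurable (`[0, +oo[ `*` `[0, +oo[ : set (R * R)) by
  apply: measurableX.
have cQ u : spm_meas E u (~` \bigcup_j Q j) = 0%E.
  (* The complement of the grid lies outside the first quadrant, or beyond the
     bound of A or B. *)
  pose SA : set (R * R) := `[c, +oo[ `*` setT.
  pose SB : set (R * R) := setT `*` `[c, +oo[.
  have mSA : measurable SA by apply: measurableX.
  have mSB : measurable SB by apply: measurableX.
  have nA : spm_meas E u SA = 0%E.
    apply: (spm_bounded EA mSA hA (c' := c)) => [|p [/=]].
      by rewrite /c -addrA ltrDl addr_gt0.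
    by rewrite in_itv /= andbT.
  have nB : spm_meas E u SB = 0%E.
    apply: (spm_bounded EB mSB hB (c' := c)) => [|p [/= _]].
      by rewrite /c addrAC ltrDr addr_gt0.
    by rewrite in_itv /= andbT.
  have nP : spm_meas E u (~` (`[0, +oo[ `*` `[0, +oo[)) = 0%E.
    have mPc := measurableC mP; rewrite spm_measE//.
    have := @spm_disjoint _ _ E _ _ u mPc mP (setICl _).
    by rewrite Epos /= => ->; rewrite inner0l.
  have mN : measurable (~` (\bigcup_j Q j)).
    apply: measurableC.
    by apply: fin_bigcup_measurable => // j _; exact: mQ.
  apply/eqP; rewrite eq_le measure_ge0 andbT.
  have mU1 := measurableC mP; have mU2 := measurableU _ _ mSA mSB.
  apply: (@le_trans _ _ (spm_meas E u (~` (`[0, +oo[ `*` `[0, +oo[)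
    `|` (SA `|` SB)))).
    apply: le_measure; rewrite ?inE//; first exact: measurableU.
    move=> p np; have [pP|] := pselect ((`[0, +oo[ `*` `[0, +oo[) p);
      last by left.
    right; case: pP => /=; rewrite !in_itv /= !andbT => q1 q2.
    have [p1c|] := ltP p.1 c; last by left; split=> //=;
      rewrite in_itv /= andbT.
    have [p2c|] := ltP p.2 c; last by right; split=> //=;
      rewrite in_itv /= andbT.
    case: np; have [||k kp] := @cell_cover R d n p q1 _ q2; rewrite ?nd//.
    by exists k.
  apply: le_trans (measureU2 _ _ _) _ => //; rewrite [X in (X + _)%E]nP add0e.
  by apply: le_trans (measureU2 _ _ _) _ => //;
    rewrite [X in (X + _)%E]nA [X in (_ + X)%E]nB adde0.
pose a (j : J) : R := j.1.+1%:R * d; pose b (j : J) : R := j.2.+1%:R * d.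
have aP (j : J) : 0 < a j by rewrite mulr_gt0.
have bP (j : J) : 0 < b j by rewrite mulr_gt0.
have natS (k : nat) : k.+1%:R * d = k%:R * d + d by rewrite -natr1 mulrDl mul1r.
have projQ j : projection_op (E (Q j)) := spm_projP E (mQ j).
have orth i j : i != j -> forall u, E (Q i) (E (Q j) u) = 0.
  move=> ij u; apply: spm_disjoint => //; apply/eqP/negPn/negP => /set0P/tQ h.
  by rewrite h eqxx in ij.
have st f X w : is_spectral_integral E f X ->
    (forall j p, Q j p -> f p <= w j <= f p + e) -> step_approx (fun j
      => E (Q j)) w X e.
  exact: spectral_step.
exists J, (fun j => E (Q j)), a, b; split=> //.
  move=> u; apply/eqP; rewrite eq_sym -subr_eq0; apply/eqP/rip_eq0.
  (* |u - sum_j P_j u|^2 = |u|^2 - sum_j (P_j u, u) vanishes because the masses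
     of the cells add up to the total mass |u|^2. *)
  have rr : real_form (@rip R H) by case: (@rip_psd R H).
  have total : \sum_j rip (E (Q j) u) u = rip u u.
    rewrite -(spm_massT E) (mass_cells mQ tQ (cQ u) (spm_finite E u)).
    by apply: eq_bigr => j _; rewrite spm_mass.
  have ripsl (F : J -> H) v : rip (\sum_j F j) v = \sum_j rip (F j) v.
    by rewrite /rip inner_suml Re_sum.
  have square : rip (\sum_j E (Q j) u) (\sum_j E (Q j) u) = rip u u.
    rewrite ripsl -total; apply: eq_bigr => j _.
    rewrite (rformC rr) ripsl (bigD1 j)//= -(projection_rip (projQ
      j)) big1 ?addr0//.
    move=> i ij; rewrite (rformC rr) projection_rip// orth ?(rform0r rr)//.
    by rewrite eq_sym.
  rewrite !(rformE rr) square (rformC rr u) ripsl total; ring.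
split.
- apply: st EA _ => j p /cellP[q1 q2 _ _]; rewrite (ltW q2) /a natS.
  by apply: lerD.
- apply: st EB _ => j p /cellP[_ _ q1 q2]; rewrite (ltW q2) /b natS.
  by apply: lerD.
- apply: st ET _ => j p /cellP[q1 q2 q3 q4].
  have k1 : p.1 <= a j by rewrite ltW.
  have k2 : p.2 <= b j by rewrite ltW.
  have k3 : a j <= p.1 + d by rewrite /a natS lerD2r.
  have k4 : b j <= p.2 + d by rewrite /b natS lerD2r.
  have z1 : 0 <= p.1 by apply: le_trans q1; rewrite mulr_ge0 ?ler0n ?ltW.
  have z2 : 0 <= p.2 by apply: le_trans q3; rewrite mulr_ge0 ?ler0n ?ltW.
  have c1 : a j <= c by rewrite -nd /a ler_pM2r// ler_nat.
  have c2 : b j <= c by rewrite -nd /b ler_pM2r// ler_nat.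
  apply/andP; split; first by apply: ler_wsqrtr; exact: ler_pM.
  rewrite -[leRHS]ger0_norm ?addr_ge0 ?sqrtr_ge0 ?(ltW e0)// -sqrtr_sqr.
  apply: ler_wsqrtr; rewrite sqrrD sqr_sqrtr ?mulr_ge0//.
  apply: (@le_trans _ _ ((p.1 + d) * (p.2 + d))).
    by apply: ler_pM => //; rewrite ltW.
  have : 0 <= Num.sqrt (p.1 * p.2) * e *+ 2 by rewrite mulrn_wge0//
    mulr_ge0 ?sqrtr_ge0 ?ltW.
  have : d * (p.1 + p.2 + d) <= d * (3 * c).
    by rewrite ler_wpM2l ?(ltW d0)//; lra.
  lra.
Qed.

End SpectralGrid.

(** * Maximality for finitely many spectral projections *)

Section StepForms.
Context {R : realType} {H : hilbertType R} {J : finType}.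
Variables (P : J -> H -> H).
Hypothesis projP : forall j, projection_op (P j).
Hypothesis orthP : forall i j, i != j -> forall u, P i (P j u) = 0.
Hypothesis sumP : forall u, \sum_j P j u = u.

Local Notation q j := (fun u v => rip (P j u) v).

Let qp j : psd_form (q j) := projection_form (projP j).
Let qr j : real_form (q j) := (qp j).1.
Let rr : real_form (@rip R H) := (@rip_psd R H).1.

Definition step_form (w : J -> R) u v := \sum_j w j * rip (P j u) v.

Lemma step_form_real w : real_form (step_form w).
Proof. by apply: real_form_sum => j; apply: real_formZ. Qed.

Lemma step_form_le w w' c u : (forall j, w j <= c * w' j) ->
  step_form w u u <= c * step_form w' u u.
Proof.
move=> ww'; rewrite mulr_sumr; apply: ler_sum => j _.
by rewrite mulrA ler_wpM2r ?(psd_ge0 (qp j)).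
Qed.

Lemma step_form_ge0 w u : (forall j, 0 <= w j) -> 0 <= step_form w u u.
Proof. by move=> w0; apply: sumr_ge0 => j _;
  rewrite mulr_ge0 ?(psd_ge0 (qp j)). Qed.

Lemma step_form_bound w u : (forall j, 0 <= w j) ->
  step_form w u u <= (\sum_j w j) * rip u u.
Proof.
move=> w0; rewrite mulr_suml; apply: ler_sum => j _; rewrite ler_wpM2l//.
rewrite -{3}(sumP u) /rip inner_suml Re_sum (bigD1 j)//= lerDl.
by apply: sumr_ge0 => i _; exact: (psd_ge0 (qp i)).
Qed.

Lemma step_op (c : J -> R) j u :
  P j (\sum_i (c i)%:C *: P i u) = (c j)%:C *: P j u.
Proof.
have pl := projection_linear (projP j).
rewrite (lin_sumE pl) (bigD1 j)//= (lin_scaleE pl)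
  projection_idem// big1 ?addr0//.
by move=> i ij; rewrite (lin_scaleE pl) orthP ?scaler0// eq_sym.
Qed.

(** The j-th term is the value of the form of P j at sqrt (a j) u + sqrt (b j) v. *)
Lemma step_form_block (a b : J -> R) u v :
  (forall j, 0 <= a j) -> (forall j, 0 <= b j) ->
  0 <= step_form a u u + 2 * step_form (fun j => Num.sqrt (a j * b j)) u v +
       step_form b v v.
Proof.
move=> a0 b0; rewrite mulr_sumr -!big_split; apply: sumr_ge0 => j _ /=.
have := psd_ge0 (qp j) ((Num.sqrt (a j))%:C *: u + (Num.sqrt (b j))%:C *: v).
rewrite !(rformE (qr j)) (rformC (qr j) v) sqrtrM//; move/le_trans; apply.
move: (sqr_sqrtr (a0 j)) (sqr_sqrtr (b0 j)).
move: (Num.sqrt (a j)) (Num.sqrt (b j)) => r s <- <-.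
by rewrite le_eqVlt; apply/orP; left; apply/eqP; ring.
Qed.

Context {V : lmodType R[i]} (h : V -> H).
Hypothesis hl : linear h.
Hypothesis hd : dense (range h).
Variables (theta : V -> V -> R) (a b : J -> R).
Hypothesis theta_psd : psd_form theta.
Hypotheses (a_gt0 : forall j, 0 < a j) (b_gt0 : forall j, 0 < b j).
Hypothesis theta_block : forall x y,
  2 * theta x y <= step_form a (h x) (h x) + step_form b (h y) (h y).

Let t j := Num.sqrt (a j * b j).
Let tr : real_form theta := theta_psd.1.
Let a0 j : 0 <= a j. Proof. exact: ltW. Qed.
Let b0 j : 0 <= b j. Proof. exact: ltW. Qed.
Let t0 j : 0 <= t j. Proof. exact: sqrtr_ge0. Qed.

(* The constant is not sharp; it only has to be the same for all j. *)
Let bound (w : J -> R) j : (forall j, 0 <= w j) ->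
  w j <= (1 + \sum_i w i / b i) * b j.
Proof.
move=> w0; rewrite -ler_pdivrMr// (bigD1 j)//= addrCA lerDl addr_ge0//.
by apply: sumr_ge0 => i _; rewrite divr_ge0.
Qed.

Lemma dense_step_approx y0 e : 0 < e -> exists y,
  step_form b (y0 - h y) (y0 - h y) <= e.
Proof.
move=> e0; have s0 : 0 < \sum_j b j + 1 by rewrite ltr_wpDl// sumr_ge0.
pose d := Num.sqrt (e / (\sum_j b j + 1)).
have d0 : 0 < d by rewrite sqrtr_gt0 divr_gt0.
have dC : 0 < d%:C :> R[i] by rewrite ltcR.
have [||z [yz [y _ yE]]] := hd (O := ball y0 d%:C).
- by exists y0; exact: ballxx.
- exact: ball_open.
exists y; rewrite yE; move: yz;
  rewrite -ball_normE /ball_ /= norm_fnorm ltcR => yz.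
apply: le_trans (step_form_bound _ b0) _.
rewrite -(fnorm_sqr rip_psd);
  apply: (@le_trans _ _ ((\sum_j b j + 1) * d ^+ 2)).
  apply: ler_pM; rewrite ?sumr_ge0 ?sqr_ge0 ?lerDl//.
  by rewrite lerXn2r ?nnegrE ?fnorm_ge0 ?ltW.
by rewrite sqr_sqrtr ?divr_ge0 ?(ltW e0) ?(ltW s0)// mulrC divfK ?gt_eqF.
Qed.

(** The set of l with gap l is a half-line, and theta <= t means that its lower
    end is 0. *)
Definition gap l := forall x,
  theta x x <= step_form t (h x) (h x) + l * step_form b (h x) (h x).

(** If theta exceeded t + (l - eta) b at x for a small eta, then x would almost
    be in the radical of the nonnegative form D = t + l b - theta. Testing
    theta = t + l b - D at x against a vector y close to (t / b + l) x, and
    bounding theta (x, y) by the block positivity, contradicts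
    b (t / b + l) ^ 2 >= a + l ^ 2 b. *)
Lemma gap_decrease l : 0 < l -> gap l -> exists2 l', 0 <= l' < l & gap l'.
Proof.
move=> l0 gl.
pose k := 1 + \sum_j a j / b j; pose k' := 1 + \sum_j (t j + l * b j) / b j.
have k0 : 0 < k by rewrite ltr_pwDl// sumr_ge0// => j _; rewrite divr_ge0.
have tl0 j : 0 <= t j + l * b j by rewrite addr_ge0 ?mulr_ge0 ?(ltW l0).
have k'0 : 0 < k' by rewrite ltr_pwDl// sumr_ge0// => j _; rewrite divr_ge0.
(* The weights c, 1 / c and r, 1 / r are used to bound theta (x, y) and D (x, y):
   1 / c + k' / r = 1, while c - 1 and then eta are so small that the errors
   (c - 1) a and r eta b are each at most l^2 b / 4. *)
pose c := 1 + l ^+ 2 / (4 * k).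
have e0 : 0 < l ^+ 2 / (4 * k) by rewrite divr_gt0 ?exprn_gt0// mulr_gt0 ?ltr0n.
have c0 : 0 < c by rewrite addr_gt0.
pose r := k' * c / (c - 1).
have c1 : 0 < c - 1 by rewrite /c addrC addKr.
have r0 : 0 < r by rewrite divr_gt0 ?mulr_gt0.
pose eta := l ^+ 2 / (4 * r + l).
have den0 : 0 < 4 * r + l by rewrite addr_gt0// mulr_gt0 ?ltr0n.
have eta0 : 0 < eta by rewrite divr_gt0 ?exprn_gt0.
have etal : eta <= l.
  by rewrite /eta ler_pdivrMr// expr2 ler_pM2l// lerDr mulr_ge0 ?(ltW r0).
have reta : 4 * (r * eta) <= l ^+ 2.
  have <- : eta * (4 * r + l) = l ^+ 2 by rewrite divfK ?gt_eqF.
  have -> : eta * (4 * r + l) = 4 * (r * eta) + eta * l by ring.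
  by rewrite lerDl mulr_ge0 ?ltW.
exists (l - eta); first by rewrite subr_ge0 etal gtrDl oppr_lt0.
move=> x; rewrite leNgt; apply/negP => lt.
pose u := h x; pose Q w := step_form w.
have Qb0 v : 0 <= Q b v v by exact: step_form_ge0.
have Qt0 v : 0 <= Q t v v by exact: step_form_ge0.
have Qr w : real_form (Q w) := step_form_real w.
have hD y z : h (y + z) = h y + h z by exact: lin_addE.
have hZ (s : R) y : h (s%:C *: y) = s%:C *: h y by exact: lin_scaleE.
pose F y z := Q t (h y) (h z) + l * Q b (h y) (h z) - theta y z.
have Fp : psd_form F.
  split=> [|y]; last by rewrite subr_ge0; exact: gl.
  split=> [y z w|s y z|y z].
  - rewrite /F hD (rformDl (Qr t)) (rformDl (Qr b)) (rformDl tr); ring.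
  - rewrite /F hZ (rformZl (Qr t)) (rformZl (Qr b)) (rformZl tr); ring.
  - by rewrite /F (rformC (Qr t)) (rformC (Qr b)) (rformC tr).
have Fle y : F y y <= k' * Q b (h y) (h y).
  apply: (@le_trans _ _ (Q (fun j => t j + l * b j) (h y) (h y))).
    rewrite /F lerBlDr.
    have -> : Q (fun j => t j + l * b j) (h y) (h y) =
        Q t (h y) (h y) + l * Q b (h y) (h y).
      by rewrite /Q /step_form mulr_sumr -big_split; apply:
        eq_bigr => j _ /=; ring.
    by rewrite lerDl (psd_ge0 theta_psd).
  by apply: step_form_le => j; apply: bound.
have Fx : F x x < eta * Q b u u by rewrite /F -/u; move: lt;
  rewrite -/u -/(Q t) -/(Q b); lra.
have Fx0 := psd_ge0 Fp x.
pose m j := t j / b j + l.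
(* The vector (t / b + l) u; it satisfies b (y0, v) = t (u, v) + l b (u, v). *)
pose y0 := \sum_j (m j)%:C *: P j u.
have Qy0 w v : Q w y0 v = \sum_j w j * (m j * rip (P j u) v).
  by apply: eq_bigr => j _; rewrite step_op (rformZl rr).
have Qby0 v : Q b y0 v = Q t u v + l * Q b u v.
  rewrite Qy0 /Q /step_form mulr_sumr -big_split; apply: eq_bigr => j _ /=.
  by rewrite /m; field; rewrite gt_eqF.
have tt j : t j * t j = a j * b j by rewrite -expr2 sqr_sqrtr// mulr_ge0.
have Qty0 : Q t y0 u = Q a u u + l * Q t u u.
  rewrite Qy0 /Q /step_form mulr_sumr -big_split; apply: eq_bigr => j _ /=.
  rewrite /m mulrA mulrDr mulrDl; congr (_ + _); last by ring.
  by congr (_ * _); rewrite mulrA tt mulfK// gt_eqF.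
have Uge : Q a u u + l ^+ 2 * Q b u u <= Q b y0 y0.
  rewrite Qby0 (rformC (Qr t)) (rformC (Qr b) u) Qty0 Qby0.
  have := mulr_ge0 (ltW l0) (Qt0 u); rewrite expr2; nra.
have key : Q b y0 y0 <= c * Q a u u + r * F x x.
  apply/ler_addgt0Pr => e e_gt0; have [y hy] := dense_step_approx y0 e_gt0.
  pose w := h y; pose W := Q b w w.
  have h1 : 2 * Q b y0 w = Q b y0 y0 + W - Q b (y0 - w) (y0 - w).
    by rewrite !(rformE (Qr b)) (rformC (Qr b) w) /W; ring.
  have h2 : 2 * theta x y <= c * Q a u u + c^-1 * W.
    pose s := Num.sqrt c; have s0 : 0 < s by rewrite sqrtr_gt0.
    have ss : s * s = c by rewrite -expr2 sqr_sqrtr// ltW.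
    have := theta_block (s%:C *: x) ((s^-1)%:C *: y).
    rewrite !hZ (rformZl tr) (rformZr tr) !(rformE (step_form_real _)).
    rewrite [s * (_ * theta _ _)]mulrA mulfV ?gt_eqF// mul1r !mulrA ss.
    by rewrite -invfM ss.
  have h3 : 2 * F x y <= r * F x x + r^-1 * (k' * W).
    apply: le_trans (psd_amgm Fp x y r0) _; rewrite lerD2l.
    by rewrite ler_wpM2l ?invr_ge0 ?(ltW r0)//; exact: Fle.
  have h4 : c^-1 + r^-1 * k' = 1.
    by rewrite /r; field; rewrite !gt_eqF.
  have h5 : Q b y0 w = theta x y + F x y by rewrite Qby0 /F -/u -/w; ring.
  have h6 : c^-1 * W + r^-1 * (k' * W) = W by rewrite mulrA -mulrDl h4 mul1r.
  move: hy; rewrite -/w -/(Q b); lra.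
have Aab : Q a u u <= k * Q b u u by apply: step_form_le => j; exact: bound.
have ck : (c - 1) * k = l ^+ 2 / 4.
  by rewrite /c; field; rewrite gt_eqF.
have h7 : (c - 1) * Q a u u <= l ^+ 2 / 4 * Q b u u.
  by rewrite -ck -mulrA ler_wpM2l ?(ltW c1).
have h8 : r * F x x <= l ^+ 2 / 4 * Q b u u.
  apply: (@le_trans _ _ (r * (eta * Q b u u))).
    by rewrite ler_wpM2l ?(ltW r0)// ltW.
  by rewrite mulrA ler_wpM2r//; lra.
have h9 : l ^+ 2 * Q b u u <= 0 by lra.
have : Q b u u <= 0 by rewrite -(@pmulr_rle0 _ (l ^+ 2)) ?exprn_gt0.
move=> h10; have : eta * Q b u u <= 0 by rewrite pmulr_rle0.
lra.
Qed.

Lemma step_gmean_max x : theta x x <= step_form t (h x) (h x).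
Proof.
pose L := [set l : R | 0 <= l /\ gap l].
have Qb0 v : 0 <= step_form b v v by exact: step_form_ge0.
have L0 : L !=set0.
  exists (1 + \sum_j a j / b j + 1); split=> [|y].
    by rewrite !addr_ge0// sumr_ge0// => j _; rewrite divr_ge0.
  have h1 : step_form a (h y) (h y) <= (1 + \sum_j a j / b j) *
    step_form b (h y) (h y).
    by apply: step_form_le => j; exact: bound.
  have h2 := theta_block y y.
  have h3 : 0 <= step_form t (h y) (h y) by exact: step_form_ge0.
  have h4 := psd_ge0 theta_psd y.
  by rewrite mulrDl mul1r; lra.
have Llb : has_lbound L by exists 0 => l [].
have Linf : has_inf L by [].
have i0 : 0 <= inf L by apply: lb_le_inf => // l [].
have gi : gap (inf L).
  move=> y; apply/ler_addgt0Pr => e e0.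
  have q0 : 0 < step_form b (h y) (h y) + 1 by rewrite ltr_wpDl.
  have [l [l0 gl] li] := inf_adherent (divr_gt0 e0 q0) Linf.
  apply: le_trans (gl y) _; rewrite -addrA lerD2l.
  apply: (@le_trans _ _ ((inf L + e / (step_form b (h y) (h y) + 1)) *
    step_form b (h y) (h y))).
    by rewrite ler_wpM2r// ltW.
  rewrite mulrDl lerD2l mulrAC ler_pdivrMr// ler_wpM2l ?(ltW e0)//.
  by rewrite lerDl.
have [i1|i1] := eqVneq (inf L) 0.
  by have := gi x; rewrite i1 mul0r addr0.
have [|l' /andP[l'0 l'i] gl'] := gap_decrease _ gi.
  by rewrite lt_def i1.
have : inf L <= l' by apply: ge_inf.
by rewrite leNgt l'i.
Qed.

End StepForms.

(** * Geometric means of positive forms *)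

Section GeometricMeanOfForms.
Context {R : realType} {V : lmodType R[i]}.
Implicit Types alpha beta s theta : V -> V -> R[i].

Lemma ler_small (x y c : R) : (forall e, 0 < e -> x <= y + e * c) -> x <= y.
Proof.
move=> h; apply/ler_addgt0Pr => e e0;
  have c0 : 0 < `|c| + 1 by rewrite ltr_wpDl.
apply: le_trans (h _ (divr_gt0 e0 c0)) _; rewrite lerD2l mulrAC ler_pdivrMr//.
by rewrite ler_pM2l// (le_trans (ler_norm c))// lerDl.
Qed.

Lemma gmean_form_positive alpha beta s : is_form_gmean alpha beta s
  -> positive_form s.
Proof.
move=> [H [h [A [B [T [[[hl _ _ _ _] _] [[Tl _] [E _ ET]] sE]]]]]].
split=> [c x y z|c x y z|x]; rewrite !sE.
- by rewrite hl Tl innerDl innerZl.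
- by rewrite hl innerDr innerZr.
- have [_ ->] := ET (h x); rewrite ler0c.
  by apply: Rintegral_ge0 => p _; exact: sqrtr_ge0.
Qed.

(** s (x, y) + s (y, x) is expressed by diagonal values of s, which are integrals;
    these are replaced by step forms, for which the claim is [step_form_block]. *)
Lemma gmean_form_block alpha beta s : is_form_gmean alpha beta s ->
  forall x y, 0 <= alpha x x + s x y + s y x + beta y y.
Proof.
move=> sG x y; have sp := gmean_form_positive sG.
move: sG => [H [h [A [B [T [[[hl _ [bA A0] [bB B0] _] [aE bE]] [bT
  [E AB ET]] sE]]]]]].
rewrite -[_ + s x y + s y x]addrA (pform_conj sp x y).
have a0 : 0 <= alpha x x by rewrite aE.
have b0 : 0 <= beta y y by rewrite bE.
apply/complex_ge0; split.
  have /complex_ge0[ia _] := a0; have /complex_ge0[ib _] := b0.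
  move: ia ib; case: (alpha x x) (beta y y) (s x y) => [a a'] [b
    b'] [c c'] /= -> ->.
  by rewrite subrr !addr0.
have sr u v : Re (s u v) = rip (T (h u)) (h v) by rewrite sE.
rewrite !ReD complex_Re_conj -mulr2n -mulr_natl sr aE bE
  -/(rip _ _) -/(rip _ _).
set u := h x; set v := h y.
have Tr : real_form (fun u v => rip (T (h u)) (h v)).
  have [[r1 r2 r3] _] := positive_form_psd sp.
  by split=> [x1 x2 z|r z z'|z z']; rewrite -!sr;
    [exact: r1|exact: r2|exact: r3].
have T2 : 2 * rip (T u) v = rip (T (u + v)) (u + v) - rip (T u) u - rip (T v) v.
  rewrite /u /v -(lin_addE hl).
  by rewrite (rformDl Tr) !(rformDr Tr) (rformC Tr y x); ring.
rewrite {}T2; apply: (@ler_small _ _ (rip u u + rip (u + v) (u + v) +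
  rip v v)) => e e0.
have [J [P [a [b [projP orthP sumP ab0 [hA hB hT]]]]]] :=
  spectral_grid e0 bA bB AB ET.
have /andP[_ h1] := hA u; have /andP[_ h2] := hB v;
  have /andP[_ h3] := hT (u + v).
have /andP[h4 _] := hT u; have /andP[h5 _] := hT v.
have := step_form_block projP u v (fun j => ltW (ab0 j).1) (fun j
  => ltW (ab0 j).2).
set t := fun j => Num.sqrt (a j * b j) in hT h3 h4 h5 *.
have tr := step_form_real projP t.
have : step_form P t (u + v) (u + v) =
    step_form P t u u + 2 * step_form P t u v + step_form P t v v.
  by rewrite (rformDl tr) !(rformDr tr) (rformC tr v); ring.
rewrite /step_form; lra.
Qed.

(** Replacing the joint spectral measure by a finite grid turns the maximality
    of the geometric mean into [step_gmean_max], up to an arbitrarily small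
    error. *)
Lemma gmean_form_max alpha beta s theta : is_form_gmean alpha beta s ->
  positive_form theta ->
  (forall x y, 0 <= alpha x x + theta x y + theta y x + beta y y) ->
  forall x, theta x x <= s x x.
Proof.
move=> sG tp block x; have sp := gmean_form_positive sG.
move: sG => [H [h [A [B [T [[[hl hd [bA A0] [bB B0] _] [aE bE]] [bT
  [E AB ET]] sE]]]]]].
rewrite (pform_diagE tp) (pform_diagE sp) lecR.
have -> : Re (s x x) = rip (T (h x)) (h x) by rewrite sE.
apply: (@ler_small _ _ (rip (h x) (h x))) => e e0.
have [J [P [a [b [projP orthP sumP ab0 [hA hB hT]]]]]] :=
  spectral_grid e0 bA bB AB ET.
have /andP[_ h3] := hT (h x); apply: le_trans h3.
have tpsd := positive_form_psd tp.
apply: (step_gmean_max projP orthP sumP hl hd tpsd).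
- by move=> j; case: (ab0 j).
- by move=> j; case: (ab0 j).
move=> y z; have := Re_ge0 (block y (- z)).
rewrite (pformNl tp) (pformNr tp) (pform_conj tp y z) !ReD !ReN
  complex_Re_conj aE bE.
rewrite -/(rip _ _) -/(rip _ _).
rewrite (lin_oppE hl) (lin_oppE bB.1).
have rr := (@rip_psd R H).1; rewrite (rformNl rr) (rformNr rr) opprK.
have /andP[h1 _] := hA (h y); have /andP[h2 _] := hB (h z).
rewrite /step_form; lra.
Qed.

End GeometricMeanOfForms.

(** * Forms of block maps *)

Section BlockForms.
Context {R : realType} {K L : hilbertType R}.
Context {M : vnAlgebra K} {N : vnAlgebra L} (F : standardForm N).
Context {V : lmodType R[i]} (t : {bilinear M -> L2 F -> V}).

Lemma cp_form_gram (Theta : M -> N) s : is_cp_form t Theta s ->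
  forall n (x : 'I_n -> M) (xi eta : 'I_n -> L2 F),
  \sum_i \sum_j ⟨std_rep F (Theta (gram x i j)) (xi j), eta i⟩ =
  s (\sum_j t (x j) (xi j)) (\sum_i t (x i) (eta i)).
Proof.
move=> [sp st] n x xi eta; rewrite (pform_sumr sp); apply: eq_bigr => i _.
by rewrite (pform_suml sp); apply: eq_bigr => j _; rewrite st.
Qed.

Lemma cp_form_block (Phi Theta Psi : M -> N) sPhi sTheta sPsi :
  is_cp_form t Phi sPhi -> is_cp_form t Theta sTheta -> is_cp_form t Psi sPsi ->
  forall n (x : 'I_n -> M) (xi : 'I_n * 'I_2 -> L2 F),
  let v l := \sum_j t (x j) (xi (j, l)) in
  \sum_p \sum_q ⟨std_rep F (block2 Phi Theta Theta Psi p.2 q.2 (gram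
    x p.1 q.1)) (xi q),
                 xi p⟩ =
  sPhi (v 0) (v 0) + sTheta (v 0) (v 1) + sTheta (v 1) (v 0) + sPsi (v 1) (v 1).
Proof.
move=> hPhi hTheta hPsi n x xi v.
pose G (l m : 'I_2) (i j : 'I_n) :=
  ⟨std_rep F (block2 Phi Theta Theta Psi l m (gram x i j)) (xi
    (j, m)), xi (i, l)⟩.
transitivity (\sum_l \sum_m \sum_i \sum_j G l m i j).
  under [RHS]eq_bigr => l _ do rewrite exchange_big.
  rewrite [RHS]exchange_big pair_bigA; apply: eq_bigr => -[i l] _ /=.
  by rewrite [RHS]exchange_big pair_bigA; apply: eq_bigr => -[j m] _.
rewrite !big_ord_recl !big_ord0 !addr0 /G /block2 /=.
have -> : lift ord0 ord0 = 1 :> 'I_2 by apply: val_inj.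
rewrite (cp_form_gram hPhi x (fun j => xi (j, 0)) (fun i => xi (i, 0))).
rewrite (cp_form_gram hTheta x (fun j => xi (j, 1)) (fun i => xi (i, 0))).
rewrite (cp_form_gram hTheta x (fun j => xi (j, 0)) (fun i => xi (i, 1))).
rewrite (cp_form_gram hPsi x (fun j => xi (j, 1)) (fun i => xi (i, 1))).
by rewrite -/(v 0) -/(v 1); ring.
Qed.

Hypothesis ht : is_tensor_product t.

(** Padding with zero vectors gives two tensors the same left factors, as needed
    for a single Gram matrix. *)
Lemma common_decomposition v w :
  exists n (x : 'I_n -> M) (xi : 'I_n * 'I_2 -> L2 F),
  v = \sum_i t (x i) (xi (i, 0)) /\ w = \sum_i t (x i) (xi (i, 1)).
Proof.
have [r ->] := tensor_spanned ht v; have [r' ->] := tensor_spanned ht w.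
pose l := [seq (p.1, (p.2, 0 : L2 F)) | p <- r] ++ [seq (p.1, (0 : L2
  F, p.2)) | p <- r'].
exists (size l), (fun i => (tnth (in_tuple l) i).1),
  (fun p => let q := tnth (in_tuple l) p.1 in if p.2 == 0 then
    q.2.1 else q.2.2).
split.
- rewrite -(big_tnth _ _ l xpredT (fun q => t q.1 q.2.1)) big_cat !big_map /=.
  by rewrite [X in _ = _ + X]big1 ?addr0// => p _; rewrite linear0r.
- rewrite -(big_tnth _ _ l xpredT (fun q => t q.1 q.2.2)) big_cat !big_map /=.
  by rewrite [X in _ = X + _]big1 ?add0r// => p _; rewrite linear0r.
Qed.

End BlockForms.

(** * Geometric means of completely positive maps *)

(* L2 F is L^2(N), and t is the canonical map (x, xi) |-> x (x) xi into the
   algebraic tensor product V of M and L^2(N) *)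
Theorem proposition3p5 (R : realType) (K L : hilbertType R)
    (M : vnAlgebra K) (N : vnAlgebra L) (F : standardForm N)
    (V : lmodType R[i]) (t : {bilinear M -> L2 F -> V})
    (ht : is_tensor_product t)
    (Phi Psi : M -> N) (hPhi : is_cp Phi) (hPsi : is_cp Psi)
    (Gamma : M -> N) (hGamma : is_cp_gmean t Phi Psi Gamma) :
  is_cp_max
    [set Theta | is_cp Theta /\ is_cp_mx (block2 Phi Theta Theta Psi)] Gamma.
Proof.
have [Gcp [sPhi [sPsi [s [fPhi fPsi sG Gs]]]]] := hGamma.
have sp := gmean_form_positive sG.
have fG : is_cp_form t Gamma s by split=> // x y xi eta; rewrite Gs.
have [[Pl _] [Ql _] [Gl _]] := And3 hPhi hPsi Gcp.
have sl := @std_rep_linear _ _ _ F.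
split.
  split=> //; split=> [i j|n a a0]; first by rewrite /block2; do 2!case: ifP.
  apply/(std_positive F) => xi.
  pose phi (b : 'I_n -> 'I_n -> M) := \sum_(p : 'I_n * 'I_2) \sum_q
    ⟨std_rep F (block2 Phi Gamma Gamma Psi p.2 q.2 (b p.1 q.1)) (xi q), xi p⟩.
  apply: (@positive_mx_ind _ _ _ _ phi) a0 => [|x].
    apply: (quadratic_linear (F := fun p q b =>
      std_rep F (block2 Phi Gamma Gamma Psi p.2 q.2 (b p.1 q.1)))) => p q c b d.
    by rewrite -sl /block2; do 2!case: ifP => _; rewrite ?(Pl, Ql, Gl).
  rewrite /phi (cp_form_block fPhi fG fPsi).
  exact: gmean_form_block.
move=> Theta [Tcp Tblock]; have [Tl _] := Tcp.
have [theta fT] := cp_form_exists ht Tcp; have [tp _] := fT.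
have block v w : 0 <= sPhi v v + theta v w + theta w v + sPsi w w.
  have [n [x [xi [-> ->]]]] := common_decomposition ht v w.
  rewrite -(cp_form_block fPhi fT fPsi).
  have := Tblock.2 n _ (gram_positive x).
  by move/(std_positive F)/(_ xi).
have Dl : linear (Gamma \- Theta).
  by move=> c a b; rewrite /= Gl Tl scalerBr opprD addrACA.
split=> // n a a0; apply/(std_positive F) => xi.
pose phi (b : 'I_n -> 'I_n -> M) := \sum_i \sum_j
  ⟨std_rep F ((Gamma \- Theta) (b i j)) (xi j), xi i⟩.
apply: (@positive_mx_ind _ _ _ _ phi) a0 => [|x].
  apply: (quadratic_linear (F := fun i j b =>
    std_rep F ((Gamma \- Theta) (b i j)))) => i j c b d.
  by rewrite -sl Dl.
have -> : phi (gram x) = s (\sum_j t (x j) (xi j)) (\sum_j t (x j) (xi j)) -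
    theta (\sum_j t (x j) (xi j)) (\sum_j t (x j) (xi j)).
  rewrite -(cp_form_gram fG) -(cp_form_gram fT) -sumrB; apply: eq_bigr => i _.
  rewrite -sumrB; apply: eq_bigr => j _ /=.
  rewrite (lin_subE sl) -[std_rep F _ - _]/(_ + _) vn_addE innerDl.
  by rewrite -scaleN1r vn_scaleE innerZl mulN1r.
by rewrite subr_ge0; exact: gmean_form_max sG tp block _.
Qed.
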